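(* There exists an entire function $f\colon\mathbb{C}\to\mathbb{C}$ that has a half-plane as a wandering domain.
   Context: $f^n$ denotes the $n$-th iterate of $f$. The Fatou set of an entire function $f$ is the set of points $z\in\mathbb{C}$ having an open neighbourhood on which the family $(f^n)_{n\ge1}$ is normal (with values in $\widehat{\mathbb{C}}$). A Fatou component is a connected component of the Fatou set; a Fatou component $\Omega$ is a wandering domain if $f^n(\Omega)\cap f^m(\Omega)=\emptyset$ whenever $n\ne m$. *)

(* Defs.v *)
From Stdlib Require Import Reals.
From Coquelicot Require Import Coquelicot.

Open Scope R_scope.

Definition entire (f : C -> C) : Prop := forall z : C, ex_derive f z.

Definition iterate (f : C -> C) (n : nat) (z : C) : C := Nat.iter n f z.

(* The Riemann sphere: [None] is the point at infinity. *)
Definition sphere : Set := option C.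

(* Euclidean distance between the stereographic projections to the unit
   sphere of R^3. *)
Definition chordal (p q : sphere) : R :=
  match p, q with
  | Some z, Some w =>
      2 * Cmod (z - w) / (sqrt (1 + Cmod z ^ 2) * sqrt (1 + Cmod w ^ 2))
  | Some z, None | None, Some z => 2 / sqrt (1 + Cmod z ^ 2)
  | None, None => 0
  end.

Definition converges_locally_uniformly
    (U : C -> Prop) (g : nat -> C -> sphere) (h : C -> sphere) : Prop :=
  forall z : C, U z ->
  exists V : C -> Prop, open V /\ V z /\
    forall eps : R, 0 < eps ->
    eventually (fun k => forall w : C, V w -> U w -> chordal (g k w) (h w) < eps).

(* The sequence of indices [s] need not be injective. *)
Definition normal_family {I : Type} (U : C -> Prop) (F : I -> C -> sphere) : Prop :=
  forall s : nat -> I,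
  exists phi : nat -> nat, (forall k, (phi k < phi (S k))%nat) /\
  exists h : C -> sphere,
    converges_locally_uniformly U (fun k => F (s (phi k))) h.

(* The index is shifted by one, so that the family is f^1, f^2, f^3, etc. *)
Definition fatou_set (f : C -> C) (z : C) : Prop :=
  exists U : C -> Prop, open U /\ U z /\
    normal_family U (fun (n : nat) (w : C) => Some (iterate f (S n) w)).

Definition connected (S : C -> Prop) : Prop :=
  forall A B : C -> Prop, open A -> open B ->
  (forall z, S z -> A z \/ B z) ->
  (exists z, S z /\ A z) -> (exists z, S z /\ B z) ->
  exists z, S z /\ A z /\ B z.

Definition connected_component (X Omega : C -> Prop) : Prop :=
  (exists z, Omega z) /\
  (forall z, Omega z -> X z) /\
  connected Omega /\
  (forall S : C -> Prop, connected S ->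
     (forall z, Omega z -> S z) -> (forall z, S z -> X z) ->
     forall z, S z -> Omega z).

Definition fatou_component (f : C -> C) (Omega : C -> Prop) : Prop :=
  connected_component (fatou_set f) Omega.

Definition image (g : C -> C) (S : C -> Prop) (w : C) : Prop :=
  exists z, S z /\ w = g z.

Definition wandering_domain (f : C -> C) (Omega : C -> Prop) : Prop :=
  fatou_component f Omega /\
  forall n m : nat, n <> m ->
  forall w : C, ~ (image (iterate f n) Omega w /\ image (iterate f m) Omega w).

(* Open half-planes, every affine line of the plane being
   Re (a z) = b for some nonzero a. *)
Definition half_plane (H : C -> Prop) : Prop :=
  exists (a : C) (b : R), a <> RtoC 0 /\ forall z : C, H z <-> b < Re (a * z)%C.

(* Main.v *)
(* The function is f = phi o E with E z = 100 e^z and phi entire.  Since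
   E o f = (E o phi) o E, the half-plane H = {|E z| < 1} wanders as soon as
   g = E o phi carries the closed unit disc almost isometrically onto discs of
   radius about 1 around centers a_n -> oo: on H the orbits then escape locally
   uniformly.  To put the line |E z| = 1 into the Julia set, points arbitrarily
   close to the circle |u| = 1 but outside it are sent by some g^n into
   D(100, 5), where |phi| <= 1/50 keeps their orbits forever.

   phi is the limit of phi_n.  Given phi_n, let T be an entire approximate
   inverse of u |-> g^n u - a_n on |u| <= sigma, with 1 < sigma.  Near a_n, the next phi
   is approximately b + T / a + b (T / sigma)^N with a = a_{n+1} = 100 e^b.  The last
   term is negligible on a disc slightly larger than the unit disc, but cancels b
   at the N points of |u| = sigma with (u / sigma)^N = -1.  Gluing with the old
   phi needs only a cutoff between two discs that are far apart relative to
   their radii.  All conditions at stage n are open, so they survive sufficiently small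
   later corrections. *)

Require Import Defs.
From Stdlib Require Import Reals Lra Lia Psatz.
From Stdlib Require Import Classical ClassicalEpsilon.
From Coquelicot Require Import Coquelicot.

Open Scope R_scope.

(** * Complex differentiability *)

(** Passing to [E] trades an unbounded half-plane for the closed unit disc. On a bounded disc,
    finitely many iterates depend continuously on the map in the sup norm over a bounded region,
    which is why every stage is an open condition. The controlled discs must shrink to exactly the
    unit disc: were g^n tame on a fixed larger disc for all n, the Fatou component would be larger
    than the half-plane. The shrinking leaves a thin annulus at each stage, and the circle |u| =
    [sigma n] lies in it.

    Near b = log (a / 100) the map [E] expands by a factor of about a, so the correction to b is T /
    a, and errors of phi must be small compared with 1 / a. Everything has to stay entire, so the
    inverse, the cutoff and the function with zeros on the circle are finite compositions of
    explicit entire functions; none is exact, and each error is chosen after the constants that will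
    amplify it. The quantitative control comes from Cauchy's inequality, proved for functions with
    continuous complex derivative by differentiating circle means with respect to the radius. *)

Definition cderiv (f : C -> C) (z l : C) : Prop :=
  forall eps, 0 < eps -> exists delta, 0 < delta /\
    forall h, Cmod h < delta -> Cmod (f (z + h) - f z - l * h)%C <= eps * Cmod h.

Definition ccont (f : C -> C) : Prop :=
  forall z eps, 0 < eps -> exists delta, 0 < delta /\
    forall h, Cmod h < delta -> Cmod (f (z + h) - f z)%C < eps.

Definition bounded_on_discs (f : C -> C) : Prop :=
  forall r, exists M, forall z, Cmod z <= r -> Cmod (f z) <= M.

(** Continuity of the derivative serves differentiation under the integral sign; the bounds on discs
    supply the M of the Cauchy estimates without a compactness argument. *)
Definition c1_entire (f : C -> C) : Prop :=
  (exists f', (forall z, cderiv f z (f' z)) /\ ccont f') /\ bounded_on_discs f.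

Lemma Cmod_tri (a b c : C) : Cmod (a - b)%C <= Cmod (a - c)%C + Cmod (c - b)%C.
Proof.
  replace (a - b)%C with ((a - c) + (c - b))%C by ring. apply Cmod_triangle.
Qed.

Lemma Cmod_minus_sym (a b : C) : Cmod (a - b)%C = Cmod (b - a)%C.
Proof. rewrite <- Cmod_opp. f_equal; ring. Qed.

Lemma Cmod_minus_le (a b : C) : Cmod (a - b)%C <= Cmod a + Cmod b.
Proof. rewrite <- (Cmod_opp b). apply Cmod_triangle. Qed.

Lemma Cmod_le_minus (a b : C) : Cmod a <= Cmod (a - b)%C + Cmod b.
Proof.
  replace a with ((a - b) + b)%C at 1 by ring. apply Cmod_triangle.
Qed.

Lemma Cmod_re_im (z : C) : Cmod z <= Rabs (Re z) + Rabs (Im z).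
Proof.
  unfold Cmod, Re, Im.
  rewrite <- (sqrt_Rsqr (Rabs (fst z) + Rabs (snd z)));
    [| generalize (Rabs_pos (fst z)) (Rabs_pos (snd z)); lra].
  apply sqrt_le_1_alt. unfold Rsqr.
  rewrite <- (pow2_abs (fst z)), <- (pow2_abs (snd z)).
  generalize (Rabs_pos (fst z)) (Rabs_pos (snd z)); nra.
Qed.

Lemma re_plus (a b : C) : Re (a + b)%C = Re a + Re b.
Proof. reflexivity. Qed.

Lemma re_minus (a b : C) : Re (a - b)%C = Re a - Re b.
Proof. reflexivity. Qed.

Lemma im_le_Cmod (z : C) : Rabs (Im z) <= Cmod z.
Proof.
  eapply Rle_trans; [|apply (Rmax_Cmod z)]. apply Rmax_r.
Qed.

Lemma ball_of_Cmod (x y : C) (eps : R) : Cmod (y - x)%C < eps -> ball x eps y.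
Proof. exact (C_NormedModule_mixin_compat1 x y eps). Qed.

Lemma Cmod_of_ball (x y : C) (eps : posreal) : ball x eps y -> Cmod (y - x)%C < 2 * eps.
Proof.
  intros H. apply C_NormedModule_mixin_compat2 in H.
  eapply Rlt_le_trans; [exact H|].
  apply Rmult_le_compat_r; [apply Rlt_le, cond_pos|].
  apply Rle_trans with (sqrt (2 * 2)); [apply sqrt_le_1_alt; lra|].
  rewrite sqrt_square; lra.
Qed.

(** The balls of the product structure on [C] are squares; halving the radius makes a square fit
    into a round disc. *)
Lemma locally_Cmod (z : C) (P : C -> Prop) :
  locally z P <-> exists d, 0 < d /\ forall w, Cmod (w - z)%C < d -> P w.
Proof.
  split.
  - intros [d Hd]. exists d. split; [apply cond_pos|].
    intros w Hw. apply Hd. now apply ball_of_Cmod.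
  - intros [d [Hd H]].
    assert (Hd2 : 0 < d / 2) by lra.
    exists (mkposreal _ Hd2). intros w Hw. apply H.
    apply Cmod_of_ball in Hw. simpl in Hw. lra.
Qed.

Lemma cderiv_ex_derive (f : C -> C) (z l : C) : cderiv f z l -> ex_derive f z.
Proof.
  intros H. exists l. split.
  - apply (is_linear_scal_l (K := C_AbsRing) (V := C_NormedModule)).
  - intros x Hx.
    assert (x = z) as ->.
    { symmetry. apply (is_filter_lim_locally_unique (K:=C_AbsRing)
        (V:=AbsRing_NormedModule C_AbsRing) z x Hx). }
    intros eps.
    destruct (H eps (cond_pos eps)) as [d [Hd Hf]].
    assert (key : forall w : C, Cmod (w - z)%C < d ->
      Cmod (f w - f z - (w - z) * l)%C <= eps * Cmod (w - z)%C).
    { intros w Hw. specialize (Hf (w - z)%C Hw).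
      replace (z + (w - z))%C with w in Hf by ring.
      now rewrite (Cmult_comm (w - z)). }
    exists (mkposreal d Hd). exact key.
Qed.

Lemma cderiv_cont (f : C -> C) (f' : C -> C) :
  (forall z, cderiv f z (f' z)) -> ccont f.
Proof.
  intros H z eps Heps.
  destruct (H z 1 Rlt_0_1) as [d [Hd Hf]].
  assert (HM : 0 < 1 + Cmod (f' z)) by (generalize (Cmod_ge_0 (f' z)); lra).
  exists (Rmin d (eps / (1 + Cmod (f' z)))). split.
  - apply Rmin_pos; [exact Hd|]. now apply Rdiv_lt_0_compat.
  - intros h Hh.
    assert (h1 := Rlt_le_trans _ _ _ Hh (Rmin_l _ _)).
    assert (h2 := Rlt_le_trans _ _ _ Hh (Rmin_r _ _)).
    specialize (Hf h h1).
    assert (Cmod (f (z + h) - f z)%C <= Cmod (f (z + h) - f z - f' z * h)%C + Cmod (f' z * h)%C)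
      by apply Cmod_le_minus.
    rewrite Cmod_mult in H0.
    apply Rlt_div_r in h2; [|exact HM].
    nra.
Qed.

Lemma ccont_comp (f g : C -> C) : ccont f -> ccont g -> ccont (fun z => f (g z)).
Proof.
  intros Hf Hg z eps Heps.
  destruct (Hf (g z) eps Heps) as [d [Hd H1]].
  destruct (Hg z d Hd) as [d' [Hd' H2]].
  exists d'. split; [exact Hd'|]. intros h Hh.
  specialize (H1 _ (H2 h Hh)).
  replace (g z + (g (z + h) - g z))%C with (g (z + h))%C in H1 by ring. exact H1.
Qed.

Lemma ccont_plus (f g : C -> C) : ccont f -> ccont g -> ccont (fun z => f z + g z)%C.
Proof.
  intros Hf Hg z eps Heps.
  destruct (Hf z (eps/2)) as [d [Hd H1]]; [lra|].
  destruct (Hg z (eps/2)) as [d' [Hd' H2]]; [lra|].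
  exists (Rmin d d'). split; [now apply Rmin_pos|]. intros h Hh.
  specialize (H1 h (Rlt_le_trans _ _ _ Hh (Rmin_l _ _))).
  specialize (H2 h (Rlt_le_trans _ _ _ Hh (Rmin_r _ _))).
  replace (f (z + h) + g (z + h) - (f z + g z))%C
    with ((f (z + h) - f z) + (g (z + h) - g z))%C by ring.
  eapply Rle_lt_trans; [apply Cmod_triangle|]. lra.
Qed.

Lemma ccont_mult (f g : C -> C) : ccont f -> ccont g -> ccont (fun z => f z * g z)%C.
Proof.
  intros Hf Hg z eps Heps.
  set (A := Cmod (f z) + 1). set (B := Cmod (g z) + 1).
  assert (HA : 0 < A) by (unfold A; generalize (Cmod_ge_0 (f z)); lra).
  assert (HB : 0 < B) by (unfold B; generalize (Cmod_ge_0 (g z)); lra).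
  destruct (Hf z (Rmin 1 (eps/(2*B)))) as [d [Hd H1]].
  { apply Rmin_pos; [lra|]. apply Rdiv_lt_0_compat; lra. }
  destruct (Hg z (eps/(2*A))) as [d' [Hd' H2]].
  { apply Rdiv_lt_0_compat; lra. }
  exists (Rmin d d'). split; [now apply Rmin_pos|]. intros h Hh.
  specialize (H1 h (Rlt_le_trans _ _ _ Hh (Rmin_l _ _))).
  specialize (H2 h (Rlt_le_trans _ _ _ Hh (Rmin_r _ _))).
  assert (h1 := Rlt_le_trans _ _ _ H1 (Rmin_l _ _)).
  assert (h2 := Rlt_le_trans _ _ _ H1 (Rmin_r _ _)).
  replace (f (z + h) * g (z + h) - (f z * g z))%C
    with (f (z + h) * (g (z + h) - g z) + (f (z + h) - f z) * g z)%C by ring.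
  eapply Rle_lt_trans; [apply Cmod_triangle|]. rewrite !Cmod_mult.
  assert (Cmod (f (z + h)%C) <= A).
  { eapply Rle_trans; [apply (Cmod_le_minus _ (f z))|]. unfold A; lra. }
  apply Rlt_div_r in h2; [|lra]. apply Rlt_div_r in H2; [|lra].
  assert (Cmod (g z) <= B) by (unfold B; lra).
  generalize (Cmod_ge_0 (f (z+h)%C)) (Cmod_ge_0 (g z))
    (Cmod_ge_0 (f (z+h) - f z)%C) (Cmod_ge_0 (g (z+h) - g z)%C). intros.
  assert (Cmod (f (z + h)%C) * Cmod (g (z + h) - g z)%C <= A * Cmod (g (z + h) - g z)%C) by nra.
  assert (Cmod (f (z + h) - f z)%C * Cmod (g z) <= Cmod (f (z + h) - f z)%C * B) by nra.
  nra.
Qed.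

Lemma ccont_const (c : C) : ccont (fun _ => c).
Proof.
  intros z eps Heps. exists 1. split; [lra|]. intros h _.
  replace (c - c)%C with (RtoC 0) by ring. rewrite Cmod_0. exact Heps.
Qed.

Lemma cderiv_const (c z : C) : cderiv (fun _ => c) z 0.
Proof.
  intros eps Heps. exists 1. split; [lra|]. intros h _.
  replace (c - c - 0 * h)%C with (RtoC 0) by ring. rewrite Cmod_0.
  generalize (Cmod_ge_0 h); nra.
Qed.

Lemma cderiv_id (z : C) : cderiv (fun w => w) z 1.
Proof.
  intros eps Heps. exists 1. split; [lra|]. intros h _.
  replace (z + h - z - 1 * h)%C with (RtoC 0) by ring. rewrite Cmod_0.
  generalize (Cmod_ge_0 h); nra.
Qed.

Lemma cderiv_plus (f g : C -> C) (z a b : C) :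
  cderiv f z a -> cderiv g z b -> cderiv (fun w => f w + g w)%C z (a + b)%C.
Proof.
  intros Hf Hg eps Heps.
  destruct (Hf (eps/2)) as [d [Hd H1]]; [lra|].
  destruct (Hg (eps/2)) as [d' [Hd' H2]]; [lra|].
  exists (Rmin d d'). split; [now apply Rmin_pos|]. intros h Hh.
  specialize (H1 h (Rlt_le_trans _ _ _ Hh (Rmin_l _ _))).
  specialize (H2 h (Rlt_le_trans _ _ _ Hh (Rmin_r _ _))).
  replace (f (z + h) + g (z + h) - (f z + g z) - (a + b) * h)%C
    with ((f (z + h) - f z - a * h) + (g (z + h) - g z - b * h))%C by ring.
  eapply Rle_trans; [apply Cmod_triangle|]. lra.
Qed.

Lemma cderiv_mult (f g : C -> C) (z a b : C) :
  cderiv f z a -> cderiv g z b ->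
  cderiv (fun w => f w * g w)%C z (a * g z + f z * b)%C.
Proof.
  intros Hf Hg eps Heps.
  set (K := 1 + Cmod (f z) + Cmod (g z) + Cmod a + Cmod b).
  assert (HK : 1 <= K).
  { unfold K. generalize (Cmod_ge_0 (f z)) (Cmod_ge_0 (g z)) (Cmod_ge_0 a) (Cmod_ge_0 b). lra. }
  set (e := Rmin 1 (eps / (4 * K))).
  assert (He : 0 < e). { apply Rmin_pos; [lra|]. apply Rdiv_lt_0_compat; lra. }
  assert (He1 : e <= 1) by apply Rmin_l.
  assert (He2 : e * (4 * K) <= eps).
  { apply Rle_div_r; [lra|]. apply Rmin_r. }
  destruct (Hf e He) as [d [Hd H1]].
  destruct (Hg e He) as [d' [Hd' H2]].
  exists (Rmin (Rmin d d') (Rmin 1 (eps / (4 * K * K)))). split.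
  { repeat apply Rmin_pos; auto; try lra. apply Rdiv_lt_0_compat; nra. }
  intros h Hh.
  assert (h0 := Rlt_le_trans _ _ _ Hh (Rmin_l _ _)).
  assert (h3 := Rlt_le_trans _ _ _ Hh (Rmin_r _ _)).
  assert (h4 := Rlt_le_trans _ _ _ h3 (Rmin_l _ _)).
  apply Rlt_le_trans with (2 := Rmin_r _ _) in h3.
  specialize (H1 h (Rlt_le_trans _ _ _ h0 (Rmin_l _ _))).
  specialize (H2 h (Rlt_le_trans _ _ _ h0 (Rmin_r _ _))).
  apply Rlt_div_r in h3; [|nra].
  set (p := (f (z + h) - f z - a * h)%C) in *.
  set (q := (g (z + h) - g z - b * h)%C) in *.
  (* The two terms containing a remainder [p] or [q] cost at most eps / 2 times |h| together, the
     quadratic term at most eps / 4 times |h|. *)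
  replace (f (z + h) * g (z + h) - f z * g z - (a * g z + f z * b) * h)%C
    with (p * (g z + b * h + q) + (f z + a * h) * q + a * h * (b * h))%C
    by (unfold p, q; ring).
  assert (Cmod (p * (g z + b * h + q))%C <= Cmod p * (Cmod (g z) + Cmod b * Cmod h + Cmod q)).
  { rewrite Cmod_mult. apply Rmult_le_compat_l; [apply Cmod_ge_0|].
    eapply Rle_trans; [apply Cmod_triangle|]. apply Rplus_le_compat_r.
    eapply Rle_trans; [apply Cmod_triangle|]. rewrite Cmod_mult. lra. }
  assert (Cmod ((f z + a * h) * q)%C <= (Cmod (f z) + Cmod a * Cmod h) * Cmod q).
  { rewrite Cmod_mult. apply Rmult_le_compat_r; [apply Cmod_ge_0|].
    eapply Rle_trans; [apply Cmod_triangle|]. rewrite Cmod_mult. lra. }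
  assert (Cmod (a * h * (b * h))%C = Cmod a * Cmod h * (Cmod b * Cmod h))
    by now rewrite !Cmod_mult.
  eapply Rle_trans; [apply Cmod_triangle|].
  eapply Rle_trans; [apply Rplus_le_compat_r, Cmod_triangle|].
  generalize (Cmod_ge_0 (f z)) (Cmod_ge_0 (g z)) (Cmod_ge_0 a) (Cmod_ge_0 b)
    (Cmod_ge_0 h) (Cmod_ge_0 p) (Cmod_ge_0 q). intros.
  set (X := Cmod h) in *.
  assert (Cmod b * X <= Cmod b) by nra. assert (Cmod a * X <= Cmod a) by nra.
  assert (e * X <= 1) by nra.
  assert (Cmod (g z) + Cmod b * X + Cmod q <= K) by (unfold K; lra).
  assert (Cmod (f z) + Cmod a * X <= K) by (unfold K; lra).
  assert (Cmod p * (Cmod (g z) + Cmod b * X + Cmod q) <= e * X * K)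
    by (apply Rmult_le_compat; nra).
  assert ((Cmod (f z) + Cmod a * X) * Cmod q <= K * (e * X))
    by (apply Rmult_le_compat; nra).
  assert (Cmod a * X * (Cmod b * X) <= (K * X) * (K * X)).
  { apply Rmult_le_compat; try nra; apply Rmult_le_compat_r; try nra; unfold K; lra. }
  assert (K * X * (K * X) <= eps / 4 * X) by nra.
  assert (2 * (e * X * K) <= eps / 2 * X) by nra.
  nra.
Qed.

Lemma cderiv_comp (f g : C -> C) (z a b : C) :
  cderiv f (g z) a -> cderiv g z b -> cderiv (fun w => f (g w)) z (a * b)%C.
Proof.
  intros Hf Hg eps Heps.
  set (K := 1 + Cmod a + Cmod b).
  assert (HK : 1 <= K).
  { unfold K. generalize (Cmod_ge_0 a) (Cmod_ge_0 b). lra. }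
  set (e := Rmin 1 (eps / (2 * K))).
  assert (He : 0 < e). { apply Rmin_pos; [lra|]. apply Rdiv_lt_0_compat; lra. }
  assert (He1 : e <= 1) by apply Rmin_l.
  assert (He2 : e * (2 * K) <= eps).
  { apply Rle_div_r; [lra|]. apply Rmin_r. }
  destruct (Hf e He) as [d [Hd H1]].
  destruct (Hg e He) as [d' [Hd' H2]].
  exists (Rmin d' (d / K)). split.
  { apply Rmin_pos; auto. apply Rdiv_lt_0_compat; lra. }
  intros h Hh.
  assert (h1 := Rlt_le_trans _ _ _ Hh (Rmin_l _ _)).
  assert (h2 := Rlt_le_trans _ _ _ Hh (Rmin_r _ _)).
  apply Rlt_div_r in h2; [|lra].
  specialize (H2 h h1).
  generalize (Cmod_ge_0 a) (Cmod_ge_0 b) (Cmod_ge_0 h). intros.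
  assert (Hk : Cmod (g (z + h) - g z)%C <= K * Cmod h).
  { eapply Rle_trans; [apply (Cmod_le_minus _ (b * h)%C)|]. rewrite Cmod_mult.
    unfold K. nra. }
  specialize (H1 (g (z + h) - g z)%C).
  replace (g z + (g (z + h) - g z))%C with (g (z + h))%C in H1 by ring.
  assert (h3 := H1 ltac:(lra)).
  replace (f (g (z + h)) - f (g z) - a * b * h)%C
   with ((f (g (z + h)) - f (g z) - a * (g (z + h) - g z)) + a * (g (z + h) - g z - b * h))%C
   by ring.
  eapply Rle_trans; [apply Cmod_triangle|]. rewrite Cmod_mult.
  set (X := Cmod h) in *.
  assert (e * Cmod (g (z + h) - g z)%C <= e * (K * X)) by (apply Rmult_le_compat_l; lra).
  assert (Cmod a * Cmod (g (z + h) - g z - b * h)%C <= K * (e * X)).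
  { apply Rmult_le_compat; try lra; try apply Cmod_ge_0. unfold K; lra. }
  nra.
Qed.

Lemma c1_entire_const (c : C) : c1_entire (fun _ => c).
Proof.
  split.
  - exists (fun _ => RtoC 0). split; [intros z; apply cderiv_const | apply ccont_const].
  - intros r. exists (Cmod c). intros; lra.
Qed.

Lemma c1_entire_id : c1_entire (fun z => z).
Proof.
  split.
  - exists (fun _ => RtoC 1). split; [intros z; apply cderiv_id | apply ccont_const].
  - intros r. exists r. auto.
Qed.

Lemma c1_entire_cont (f : C -> C) : c1_entire f -> ccont f.
Proof. intros [[f' [H _]] _]. exact (cderiv_cont f f' H). Qed.

Lemma c1_entire_plus (f g : C -> C) :
  c1_entire f -> c1_entire g -> c1_entire (fun z => f z + g z)%C.
Proof.
  intros [[f' [Hf Cf]] Bf] [[g' [Hg Cg]] Bg]. split.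
  - exists (fun z => f' z + g' z)%C. split.
    + intros z. now apply cderiv_plus.
    + now apply ccont_plus.
  - intros r. destruct (Bf r) as [M HM], (Bg r) as [N HN].
    exists (M + N). intros z Hz. eapply Rle_trans; [apply Cmod_triangle|].
    apply Rplus_le_compat; auto.
Qed.

Lemma c1_entire_mult (f g : C -> C) :
  c1_entire f -> c1_entire g -> c1_entire (fun z => f z * g z)%C.
Proof.
  intros Ef Eg. assert (cf := c1_entire_cont f Ef). assert (cg := c1_entire_cont g Eg).
  destruct Ef as [[f' [Hf Cf]] Bf], Eg as [[g' [Hg Cg]] Bg]. split.
  - exists (fun z => f' z * g z + f z * g' z)%C. split.
    + intros z. now apply cderiv_mult.
    + apply ccont_plus; now apply ccont_mult.
  - intros r. destruct (Bf r) as [M HM], (Bg r) as [N HN].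
    exists (M * N). intros z Hz. rewrite Cmod_mult.
    apply Rmult_le_compat; auto using Cmod_ge_0.
Qed.

Lemma c1_entire_comp (f g : C -> C) :
  c1_entire f -> c1_entire g -> c1_entire (fun z => f (g z)).
Proof.
  intros [[f' [Hf Cf]] Bf] Eg. assert (cg := c1_entire_cont g Eg).
  destruct Eg as [[g' [Hg Cg]] Bg]. split.
  - exists (fun z => f' (g z) * g' z)%C. split.
    + intros z. now apply cderiv_comp.
    + apply ccont_mult; [|assumption]. now apply (ccont_comp f' g).
  - intros r. destruct (Bg r) as [N HN]. destruct (Bf N) as [M HM].
    exists M. intros z Hz. auto.
Qed.

Lemma c1_entire_ext (f g : C -> C) :
  (forall z, f z = g z) -> c1_entire f -> c1_entire g.
Proof.
  intros E [[f' [Hf Cf]] Bf]. split.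
  - exists f'. split; [|exact Cf]. intros z eps Heps.
    destruct (Hf z eps Heps) as [d [Hd H]]. exists d. split; [exact Hd|].
    intros h Hh. rewrite <- !E. auto.
  - intros r. destruct (Bf r) as [M HM]. exists M. intros z Hz. rewrite <- E. auto.
Qed.

Lemma c1_entire_minus (f g : C -> C) :
  c1_entire f -> c1_entire g -> c1_entire (fun z => f z - g z)%C.
Proof.
  intros Hf Hg. apply (c1_entire_ext (fun z => f z + (- (1)) * g z)%C).
  - intros z; ring.
  - apply c1_entire_plus; [exact Hf|]. apply c1_entire_mult; [apply c1_entire_const|exact Hg].
Qed.

Lemma c1_entire_pow (f : C -> C) (n : nat) :
  c1_entire f -> c1_entire (fun z => f z ^ n)%C.
Proof.
  intros Hf. induction n as [|n IH]; simpl.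
  - apply c1_entire_const.
  - now apply (c1_entire_mult f).
Qed.

(** * The complex exponential and mean value inequalities *)

Lemma lipschitz_of_derive (f df : R -> R) (K a b : R) :
  (forall x, is_derive f x (df x)) -> (forall x, Rabs (df x) <= K) ->
  Rabs (f b - f a) <= K * Rabs (b - a).
Proof.
  intros Hd HK.
  destruct (MVT_gen f a b df) as [c [_ Hc]].
  - intros x _; apply Hd.
  - intros x _. apply derivable_continuous_pt. exists (df x). apply is_derive_Reals, Hd.
  - rewrite Hc, Rabs_mult. apply Rmult_le_compat_r; [apply Rabs_pos | apply HK].
Qed.

Lemma sin_lipschitz (a b : R) : Rabs (sin b - sin a) <= Rabs (b - a).
Proof.
  rewrite <- (Rmult_1_l (Rabs (b - a))).
  apply (lipschitz_of_derive sin cos).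
  - intros x. auto_derive; [exact I | ring].
  - intros x. apply Rabs_le. generalize (COS_bound x); lra.
Qed.

Lemma cos_lipschitz (a b : R) : Rabs (cos b - cos a) <= Rabs (b - a).
Proof.
  rewrite <- (Rmult_1_l (Rabs (b - a))).
  apply (lipschitz_of_derive cos (fun x => - sin x)).
  - intros x. auto_derive; [exact I | ring].
  - intros x. apply Rabs_le. generalize (SIN_bound x); lra.
Qed.

Definition Cexp (z : C) : C := (exp (Re z) * cos (Im z), exp (Re z) * sin (Im z)).

Lemma Cexp_plus (z w : C) : Cexp (z + w) = (Cexp z * Cexp w)%C.
Proof.
  unfold Cexp, Re, Im. simpl. rewrite exp_plus, cos_plus, sin_plus.
  unfold Cmult; simpl. f_equal; ring.
Qed.

Lemma Cmod_Cexp (z : C) : Cmod (Cexp z) = exp (Re z).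
Proof.
  unfold Cmod, Cexp; simpl.
  match goal with |- sqrt ?x = _ => replace x with (Rsqr (exp (Re z))) end.
  - rewrite sqrt_Rsqr; [reflexivity | apply Rlt_le, exp_pos].
  - generalize (sin2_cos2 (Im z)). unfold Rsqr. intros H.
    transitivity (exp (Re z) * exp (Re z) *
      (sin (Im z) * sin (Im z) + cos (Im z) * cos (Im z))); [rewrite H; ring | ring].
Qed.

Lemma Cexp_RtoC (x : R) : Cexp x = RtoC (exp x).
Proof.
  unfold Cexp, RtoC, Re, Im; simpl. rewrite cos_0, sin_0. f_equal; ring.
Qed.

(** Both bounds come from 1 + y <= exp y: at y = x, and at y = -x, which gives exp x <= 1 / (1 - x)
    = 1 + x + x^2 / (1 - x) with 1 - x >= 1/2. *)
Lemma exp_taylor1 (x : R) : Rabs x <= 1 / 2 -> 0 <= exp x - 1 - x <= 2 * x ^ 2.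
Proof.
  intros H. apply Rabs_le_between in H.
  generalize (exp_ineq1_le x) (exp_ineq1_le (- x)). intros H1 H2.
  rewrite exp_Ropp in H2. split; [lra|].
  assert (0 < exp x) by apply exp_pos.
  assert (exp x * (1 - x) <= 1).
  { replace 1 with (exp x * / exp x) at 2 by (field; lra).
    apply Rmult_le_compat_l; lra. }
  nra.
Qed.

Lemma cos_lower (y : R) : 1 - cos y <= y ^ 2 / 2.
Proof.
  replace y with (2 * (y / 2)) at 1 by field. rewrite cos_2a_sin.
  generalize (sin_lipschitz 0 (y / 2)). rewrite sin_0, !Rminus_0_r. intros H.
  assert (H2 := Rmult_le_compat _ _ _ _ (Rabs_pos _) (Rabs_pos _) H H).
  rewrite <- !Rabs_mult in H2.
  rewrite !Rabs_pos_eq in H2 by nra. nra.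
Qed.

Lemma sin_taylor1 (y : R) : Rabs (sin y - y) <= y ^ 2.
Proof.
  destruct (MVT_gen (fun y => sin y - y) 0 y (fun y => cos y - 1)) as [c [Hc H]].
  - intros x _. auto_derive; [exact I | ring].
  - intros x _. apply derivable_continuous_pt. reg.
  - rewrite sin_0 in H. replace (sin y - y) with ((cos c - 1) * (y - 0)) by lra.
    generalize (cos_lipschitz 0 c). rewrite cos_0, !Rminus_0_r, Rabs_mult.
    intros H1.
    assert (Rabs c <= Rabs y).
    { unfold Rmin, Rmax in Hc. destruct (Rle_dec 0 y).
      - rewrite !Rabs_pos_eq; lra.
      - rewrite (Rabs_left1 y), (Rabs_left1 c); lra. }
    rewrite <- (pow2_abs y). generalize (Rabs_pos y); nra.
Qed.

(** The real part contributes 2 x^2 + y^2 and the imaginary part 2 |x| |y| + y^2, in sum at most 3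
    (x^2 + y^2). *)
Lemma Cexp_taylor1 (h : C) : Cmod h <= 1 / 2 -> Cmod (Cexp h - 1 - h)%C <= 3 * Cmod h ^ 2.
Proof.
  intros H. destruct h as [x y].
  assert (Hx : Rabs x <= 1 / 2) by (generalize (re_le_Cmod (x, y)); simpl; lra).
  rewrite Cmod2_alt. simpl (Re (x, y)). simpl (Im (x, y)).
  eapply Rle_trans; [apply Cmod_re_im|]. unfold Cexp. simpl.
  generalize (exp_taylor1 x Hx) (cos_lower y) (sin_taylor1 y) (COS_bound y). intros H1 H2 H3 H4.
  assert (Hx' := Hx). apply Rabs_le_between in Hx'.
  generalize (exp_pos x). intros Hp.
  assert (exp x <= 2) by nra.
  assert (Hs : Rabs (sin y) <= Rabs y).
  { generalize (sin_lipschitz 0 y). now rewrite sin_0, !Rminus_0_r. }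
  replace (exp x * cos y + - (1) + - x) with ((exp x - 1 - x) - exp x * (1 - cos y)) by ring.
  replace (exp x * sin y + - 0 + - y) with ((exp x - 1) * sin y + (sin y - y)) by ring.
  assert (Rabs (exp x - 1 - x - exp x * (1 - cos y)) <= 2 * x ^ 2 + y ^ 2).
  { apply Rabs_le. assert (0 <= exp x * (1 - cos y) <= y ^ 2) by nra.
    generalize (pow2_ge_0 x). lra. }
  assert (Rabs ((exp x - 1) * sin y + (sin y - y)) <= 2 * (Rabs x * Rabs y) + y ^ 2).
  { eapply Rle_trans; [apply Rabs_triang|]. rewrite Rabs_mult.
    assert (Rabs (exp x - 1) <= 2 * Rabs x).
    { replace (exp x - 1) with (x + (exp x - 1 - x)) by ring.
      eapply Rle_trans; [apply Rabs_triang|]. rewrite (Rabs_pos_eq (exp x - 1 - x)) by lra.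
      rewrite <- (pow2_abs x) in H1. generalize (Rabs_pos x). nra. }
    generalize (Rabs_pos x) (Rabs_pos y) (Rabs_pos (sin y)) (Rabs_pos (exp x - 1)). nra. }
  assert (2 * (Rabs x * Rabs y) <= x ^ 2 + y ^ 2).
  { rewrite <- (pow2_abs x), <- (pow2_abs y). generalize (pow2_ge_0 (Rabs x - Rabs y)). nra. }
  lra.
Qed.

Lemma cderiv_Cexp (z : C) : cderiv Cexp z (Cexp z).
Proof.
  intros eps Heps. set (M := Cmod (Cexp z)).
  assert (HM : 0 < M) by (unfold M; rewrite Cmod_Cexp; apply exp_pos).
  exists (Rmin (1/2) (eps / (3 * M))). split.
  - apply Rmin_pos; [lra|]. apply Rdiv_lt_0_compat; lra.
  - intros h Hh.
    assert (h1 := Rlt_le_trans _ _ _ Hh (Rmin_l _ _)).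
    assert (h2 := Rlt_le_trans _ _ _ Hh (Rmin_r _ _)).
    apply Rlt_div_r in h2; [|lra].
    rewrite Cexp_plus.
    replace (Cexp z * Cexp h - Cexp z - Cexp z * h)%C with (Cexp z * (Cexp h - 1 - h))%C by ring.
    rewrite Cmod_mult. fold M.
    generalize (Cexp_taylor1 h ltac:(lra)) (Cmod_ge_0 h). intros.
    assert (M * Cmod (Cexp h - 1 - h)%C <= M * (3 * Cmod h ^ 2)) by (apply Rmult_le_compat_l; lra).
    nra.
Qed.

Lemma c1_entire_Cexp : c1_entire Cexp.
Proof.
  split.
  - exists Cexp. split; [exact cderiv_Cexp|]. exact (cderiv_cont _ _ cderiv_Cexp).
  - intros r. exists (exp r). intros z Hz. rewrite Cmod_Cexp.
    generalize (re_le_Cmod z) (Rle_abs (Re z)). intros.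
    destruct (Rle_lt_or_eq_dec (Re z) r) as [H1|H1]; [lra| |].
    + now apply Rlt_le, exp_increasing.
    + rewrite H1; lra.
Qed.

(** The bridge to real calculus: a complex value is determined by the real numbers Re (lam w) for
    all [lam], and to these the real mean value theorem and real integration apply. *)
Lemma cderiv_curve (f : C -> C) (x y : R -> R) (t a b : R) (l lam : C) :
  is_derive x t a -> is_derive y t b -> cderiv f (x t, y t) l ->
  is_derive (fun s => Re (lam * f (x s, y s))%C) t (Re (lam * (l * (a, b)))%C).
Proof.
  intros Hx Hy Hf. apply is_derive_Reals in Hx, Hy. apply is_derive_Reals.
  intros eps Heps.
  set (L := 1 + Cmod lam). set (B := 3 + Rabs a + Rabs b + 2 * Cmod l).
  assert (HL : 1 <= L) by (unfold L; generalize (Cmod_ge_0 lam); lra).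
  assert (HB : 3 <= B) by (unfold B; generalize (Rabs_pos a) (Rabs_pos b) (Cmod_ge_0 l); lra).
  set (e := Rmin 1 (eps / (2 * L * B))).
  assert (He : 0 < e). { apply Rmin_pos; [lra|]. apply Rdiv_lt_0_compat; nra. }
  assert (He1 : e <= 1) by apply Rmin_l.
  assert (He2 : e * (2 * L * B) <= eps).
  { apply Rle_div_r; [nra|]. apply Rmin_r. }
  destruct (Hx e He) as [d1 H1]. destruct (Hy e He) as [d2 H2].
  destruct (Hf e He) as [d3 [Hd3 H3]].
  assert (Hd : 0 < Rmin (Rmin d1 d2) (d3 / B)).
  { repeat apply Rmin_pos; try apply cond_pos. apply Rdiv_lt_0_compat; lra. }
  exists (mkposreal _ Hd). intros h Hh0 Hh. cbn [pos] in Hh.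
  assert (h0 := Rlt_le_trans _ _ _ Hh (Rmin_l _ _)).
  assert (h3 := Rlt_le_trans _ _ _ Hh (Rmin_r _ _)).
  assert (h1 := Rlt_le_trans _ _ _ h0 (Rmin_l _ _)).
  assert (h2 := Rlt_le_trans _ _ _ h0 (Rmin_r _ _)).
  apply Rlt_div_r in h3; [|lra].
  assert (Hhp : 0 < Rabs h) by now apply Rabs_pos_lt.
  assert (K1 : forall u A, Rabs (u / h - A) < e -> Rabs (u - A * h) <= e * Rabs h).
  { intros u A Hu. replace (u - A * h) with ((u / h - A) * h) by (field; exact Hh0).
    rewrite Rabs_mult. apply Rmult_le_compat_r; lra. }
  specialize (H1 h Hh0 h1). specialize (H2 h Hh0 h2).
  apply K1 in H1. apply K1 in H2.
  set (k := (x (t + h) - x t, y (t + h) - y t) : C).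
  assert (Hk1 : Cmod (k - (a, b) * h)%C <= 2 * e * Rabs h).
  { eapply Rle_trans; [apply Cmod_re_im|]. unfold k, Re, Im; simpl.
    replace (x (t + h) - x t + - (a * h - b * 0)) with (x (t + h) - x t - a * h) by ring.
    replace (y (t + h) - y t + - (a * 0 + b * h)) with (y (t + h) - y t - b * h) by ring.
    lra. }
  assert (Hk2 : Cmod k <= (B - 2 * Cmod l) * Rabs h).
  { eapply Rle_trans; [apply (Cmod_le_minus _ ((a, b) * h)%C)|].
    rewrite Cmod_mult, Cmod_R.
    assert (Cmod (a, b) <= Rabs a + Rabs b) by apply (Cmod_re_im (a, b)).
    unfold B. nra. }
  assert (Hk3 : Cmod k < d3).
  { generalize (Cmod_ge_0 l). nra. }
  specialize (H3 k Hk3).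
  replace ((x t, y t) + k)%C with ((x (t + h), y (t + h)) : C) in H3
    by (unfold k, Cplus; simpl; f_equal; ring).
  set (F1 := f (x (t + h), y (t + h))) in *. set (F0 := f (x t, y t)) in *.
  replace ((Re (lam * F1)%C - Re (lam * F0)%C) / h - Re (lam * (l * (a, b)))%C)
   with (Re (lam * (F1 - F0 - l * k + l * (k - (a, b) * h)))%C / h).
  2:{ replace (lam * (F1 - F0 - l * k + l * (k - (a, b) * h)))%C
        with (lam * F1 - lam * F0 - lam * (l * (a, b)) * h)%C by ring.
      rewrite !re_minus, re_scal_r. field. exact Hh0. }
  rewrite Rabs_div by exact Hh0.
  apply Rlt_div_l; [exact Hhp|].
  eapply Rle_lt_trans; [apply re_le_Cmod|]. rewrite Cmod_mult.
  assert (Cmod (F1 - F0 - l * k + l * (k - (a, b) * h))%C <= e * B * Rabs h).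
  { eapply Rle_trans; [apply Cmod_triangle|]. rewrite Cmod_mult.
    generalize (Cmod_ge_0 l). intros.
    assert (e * Cmod k <= e * ((B - 2 * Cmod l) * Rabs h)) by (apply Rmult_le_compat_l; lra).
    assert (Cmod l * Cmod (k - (a, b) * h)%C <= Cmod l * (2 * e * Rabs h))
      by (apply Rmult_le_compat_l; lra).
    nra. }
  assert (Cmod lam * Cmod (F1 - F0 - l * k + l * (k - (a, b) * h))%C <= L * (e * B * Rabs h)).
  { apply Rmult_le_compat; try apply Cmod_ge_0; [unfold L; lra | assumption]. }
  assert (L * (e * B * Rabs h) <= eps / 2 * Rabs h) by nra.
  nra.
Qed.

Lemma Cmod_rotate (D : C) : exists lam, Cmod lam = 1 /\ (lam * D)%C = RtoC (Cmod D).
Proof.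
  destruct (Req_dec (Cmod D) 0) as [H|H].
  - exists 1%C. split; [apply Cmod_1|]. rewrite (Cmod_eq_0 _ H), Cmod_0. ring.
  - exists (Cconj D / Cmod D)%C.
    assert (HD : RtoC (Cmod D) <> 0).
    { intros E. apply H. now apply RtoC_inj. }
    split.
    + rewrite Cmod_div by exact HD. rewrite Cmod_conj, Cmod_R, Rabs_pos_eq; [field; exact H|].
      apply Cmod_ge_0.
    + replace (Cconj D / Cmod D * D)%C with (D * Cconj D / Cmod D)%C by (field; exact HD).
      rewrite <- Cmod2_conj. rewrite RtoC_pow. field. exact HD.
Qed.

(** The mean value theorem fails for complex values, so it is applied to Re (lam f) along the
    segment, where the unimodular [lam] rotates f y - f x onto its modulus. *)
Lemma Cmod_mean_value (f f' : C -> C) (x y : C) (M : R) :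
  (forall z, cderiv f z (f' z)) ->
  (forall t, 0 <= t <= 1 -> Cmod (f' (x + t * (y - x))%C) <= M) ->
  Cmod (f y - f x)%C <= M * Cmod (y - x)%C.
Proof.
  intros Hf HM.
  destruct (Cmod_rotate (f y - f x)%C) as [lam [Hl HD]].
  set (p := fun t => Re x + t * (Re y - Re x)).
  set (q := fun t => Im x + t * (Im y - Im x)).
  assert (Hpq : forall t, (p t, q t) = (x + t * (y - x))%C).
  { intros t. destruct x, y. unfold p, q, Cplus, Cmult, Cminus, RtoC, Re, Im; simpl.
    f_equal; ring. }
  assert (Hd : forall t, is_derive (fun s => Re (lam * f (p s, q s))%C) t
     (Re (lam * (f' (p t, q t) * ((Re y - Re x)%R, (Im y - Im x)%R)))%C)).
  { intros t. apply cderiv_curve.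
    - unfold p. auto_derive; [exact I | ring].
    - unfold q. auto_derive; [exact I | ring].
    - apply Hf. }
  destruct (MVT_gen _ 0 1 _ (fun t _ => Hd t)) as [c [Hc H]].
  { intros t _. apply derivable_continuous_pt. eexists. apply is_derive_Reals, Hd. }
  rewrite Rmin_left, Rmax_right in Hc by lra.
  rewrite !Hpq in H.
  replace (x + 1 * (y - x))%C with y in H by ring.
  replace (x + 0 * (y - x))%C with x in H by ring.
  rewrite <- re_minus in H.
  replace (lam * f y - lam * f x)%C with (lam * (f y - f x))%C in H by ring.
  rewrite HD, re_RtoC, Rminus_0_r, Rmult_1_r in H. rewrite H.
  eapply Rle_trans; [eapply Rle_trans; [apply Rle_abs | apply re_le_Cmod]|].
  rewrite !Cmod_mult, Hl, Rmult_1_l.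
  replace ((Re y - Re x, Im y - Im x) : C) with (y - x)%C by reflexivity.
  apply Rmult_le_compat_r; [apply Cmod_ge_0|]. now apply HM.
Qed.

Lemma Cexp_minus_1 (w : C) : Cmod w <= 1 / 2 -> Cmod (Cexp w - 1)%C <= 5 / 2 * Cmod w.
Proof.
  intros H. generalize (Cexp_taylor1 w H) (Cmod_ge_0 w). intros.
  eapply Rle_trans; [apply (Cmod_le_minus _ w)|].
  assert (3 * Cmod w ^ 2 <= 3 / 2 * Cmod w) by nra. lra.
Qed.

(** * Cauchy estimates *)

Definition polar (z : C) (r t : R) : C := (Re z + r * cos t, Im z + r * sin t).

Lemma Cmod_polar (z : C) (r t : R) : 0 <= r -> Cmod (polar z r t - z)%C = r.
Proof.
  intros Hr. unfold polar, Cmod, Cminus, Cplus, Copp, Re, Im; simpl.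
  match goal with |- sqrt ?x = _ => replace x with (Rsqr r) end.
  - now apply sqrt_Rsqr.
  - generalize (sin2_cos2 t). unfold Rsqr. intros H.
    transitivity (r * r * (sin t * sin t + cos t * cos t)); [rewrite H; ring | ring].
Qed.

Section CauchyEstimate.

Variables (f f' : C -> C) (z : C).
Hypothesis (Hf : forall w, cderiv f w (f' w)) (Cf : ccont f').

(* u = Re (lam e^{-it} f (z + r e^{it})), and m is its radial derivative.  The
   integrals h of u and hm of m over the circle satisfy h' = hm and r hm = h, so
   h is linear in r, which is Cauchy's formula h r = 2 pi r Re (lam f' z). *)
Let u (lam : C) (r t : R) : R :=
  cos t * Re (lam * f (polar z r t))%C + sin t * Re (- Ci * lam * f (polar z r t))%C.
Let m (lam : C) (r t : R) : R := Re (lam * f' (polar z r t))%C.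

Lemma circle_radial_derive (lam : C) (r t : R) :
  is_derive (fun s => u lam s t) r (m lam r t).
Proof.
  assert (H : forall mu, is_derive (fun s => Re (mu * f (polar z s t))%C) r
      (Re (mu * (f' (polar z r t) * (cos t, sin t)))%C)).
  { intros mu. unfold polar. apply cderiv_curve; [| |apply Hf];
    auto_derive; try exact I; ring. }
  unfold u.
  evar_last.
  - apply (is_derive_plus (K := R_AbsRing) (V := R_NormedModule));
      apply is_derive_scal; apply H.
  - unfold m, plus, scal; simpl. unfold mult; simpl.
    generalize (sin2_cos2 t). unfold Rsqr. intros Hsc.
    destruct (f' (polar z r t)) as [a b], lam as [p q]; simpl.
    match goal with |- _ = ?x =>
      transitivity (x * (sin t * sin t + cos t * cos t)); [ring | rewrite Hsc; ring] end.
Qed.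

(** Differentiating the factor e^{-it} multiplies [lam] by -i; differentiating z + r e^{it} gives i
    r e^{it}, whose exponential cancels e^{-it}. *)
Lemma circle_angular_derive (lam : C) (r t : R) :
  is_derive (fun s => u lam r s) t (u (- Ci * lam)%C r t + r * m (Ci * lam)%C r t).
Proof.
  assert (H : forall mu, is_derive (fun s => Re (mu * f (polar z r s))%C) t
      (Re (mu * (f' (polar z r t) * ((- r * sin t)%R, (r * cos t)%R)))%C)).
  { intros mu. unfold polar. apply cderiv_curve; [| |apply Hf];
    auto_derive; try exact I; ring. }
  unfold u.
  evar_last.
  - apply (is_derive_plus (K := R_AbsRing) (V := R_NormedModule)).
    + apply (is_derive_mult (K := R_AbsRing) cos); [| apply H | exact Rmult_comm].
      apply is_derive_Reals, derivable_pt_lim_cos.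
    + apply (is_derive_mult (K := R_AbsRing) sin); [| apply H | exact Rmult_comm].
      apply is_derive_Reals, derivable_pt_lim_sin.
  - unfold m, plus, mult; simpl.
    generalize (sin2_cos2 t). unfold Rsqr. intros Hsc.
    destruct (f' (polar z r t)) as [a b], lam as [p q], (f (polar z r t)) as [c d]; simpl.
    match goal with |- ?x = ?y =>
      transitivity (y + r * (p * b + q * a) * (1 - (sin t * sin t + cos t * cos t)));
      [ring | rewrite Hsc; ring] end.
Qed.

Lemma circle_derive_continuous (lam : C) (r t : R) : continuity_2d_pt (m lam) r t.
Proof.
  intros eps.
  set (L := 1 + Cmod lam).
  assert (HL : 0 < L) by (unfold L; generalize (Cmod_ge_0 lam); lra).
  destruct (Cf (polar z r t) (eps / L)) as [d [Hd H]].
  { apply Rdiv_lt_0_compat; [apply cond_pos | exact HL]. }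
  set (K := 4 * (1 + Rabs r)).
  assert (HK : 0 < K) by (unfold K; generalize (Rabs_pos r); lra).
  assert (Hd' : 0 < d / K) by now apply Rdiv_lt_0_compat.
  exists (mkposreal _ Hd'). intros r1 t1 Hr Ht. cbn [pos] in *.
  apply Rlt_div_r in Hr; [|exact HK]. apply Rlt_div_r in Ht; [|exact HK].
  set (k := (polar z r1 t1 - polar z r t)%C).
  assert (Hk : Cmod k < d).
  { eapply Rle_lt_trans; [apply Cmod_re_im|]. unfold k, polar; simpl.
    assert (A : forall c c0, Rabs c <= 1 -> Rabs (c - c0) <= Rabs (t1 - t) ->
      Rabs (r1 * c - r * c0) <= Rabs (r1 - r) + Rabs r * Rabs (t1 - t)).
    { intros c c0 H1 H2. replace (r1 * c - r * c0) with ((r1 - r) * c + r * (c - c0)) by ring.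
      eapply Rle_trans; [apply Rabs_triang|]. rewrite !Rabs_mult.
      generalize (Rabs_pos (r1 - r)) (Rabs_pos r). nra. }
    assert (A1 := A (cos t1) (cos t) ltac:(apply Rabs_le, COS_bound) (cos_lipschitz t t1)).
    assert (A2 := A (sin t1) (sin t) ltac:(apply Rabs_le, SIN_bound) (sin_lipschitz t t1)).
    replace (Re z + r1 * cos t1 + - (Re z + r * cos t)) with (r1 * cos t1 - r * cos t) by ring.
    replace (Im z + r1 * sin t1 + - (Im z + r * sin t)) with (r1 * sin t1 - r * sin t) by ring.
    unfold K in *. generalize (Rabs_pos r) (Rabs_pos (t1 - t)) (Rabs_pos (r1 - r)). nra. }
  specialize (H k Hk).
  replace (polar z r t + k)%C with (polar z r1 t1) in H by (unfold k; ring).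
  unfold m. rewrite <- re_minus.
  replace (lam * f' (polar z r1 t1) - lam * f' (polar z r t))%C
    with (lam * (f' (polar z r1 t1) - f' (polar z r t)))%C by ring.
  eapply Rle_lt_trans; [apply re_le_Cmod|]. rewrite Cmod_mult.
  apply Rlt_div_r in H; [|exact HL].
  assert (Cmod lam <= L) by (unfold L; lra).
  generalize (Cmod_ge_0 (f' (polar z r1 t1) - f' (polar z r t))%C). nra.
Qed.

Lemma circle_continuous_t (lam : C) (r t : R) : continuous (u lam r) t.
Proof.
  apply (ex_derive_continuous (K := R_AbsRing) (V := R_NormedModule)).
  eexists. apply circle_angular_derive.
Qed.

Lemma circle_derive_continuous_t (lam : C) (r t : R) : continuous (m lam r) t.
Proof.
  apply continuity_pt_filterlim. intros eps Heps.
  destruct (circle_derive_continuous lam r t (mkposreal eps Heps)) as [d Hd].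
  exists d. split; [apply cond_pos|]. intros x [_ Hx]. apply Hd; [|exact Hx].
  replace (r - r) with 0 by ring. rewrite Rabs_R0. apply cond_pos.
Qed.

Let h (lam : C) (r : R) : R := RInt (u lam r) 0 (2 * PI).
Let hm (lam : C) (r : R) : R := RInt (m lam r) 0 (2 * PI).

Lemma circle_mean_derive (lam : C) (r : R) : is_derive (h lam) r (hm lam r).
Proof.
  unfold h, hm.
  assert (HD : forall s t, Derive (fun x => u lam x t) s = m lam s t).
  { intros s t. apply is_derive_unique, circle_radial_derive. }
  rewrite <- (RInt_ext (fun t => Derive (fun x => u lam x t) r)) by (intros; apply HD).
  apply (is_derive_RInt_param (fun r t => u lam r t)).
  - apply filter_forall. intros s t _. eexists. apply circle_radial_derive.
  - intros t _. apply continuity_2d_pt_ext with (m lam).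
    + intros; symmetry; apply HD.
    + apply circle_derive_continuous.
  - apply filter_forall. intros s.
    apply (ex_RInt_continuous (V := R_CompleteNormedModule)).
    intros t _. apply circle_continuous_t.
Qed.

(** By [circle_angular_derive] at -i lam, r m - u is the t-derivative of a 2 pi-periodic function,
    so its integral over the circle vanishes. *)
Lemma circle_mean_euler (lam : C) (r : R) : r * hm lam r = h lam r.
Proof.
  assert (Em : ex_RInt (m lam r) 0 (2 * PI)).
  { apply (ex_RInt_continuous (V := R_CompleteNormedModule)).
    intros t _. apply circle_derive_continuous_t. }
  assert (Eu : ex_RInt (u lam r) 0 (2 * PI)).
  { apply (ex_RInt_continuous (V := R_CompleteNormedModule)).
    intros t _. apply circle_continuous_t. }
  assert (H : is_RInt (fun t => r * m lam r t - u lam r t) 0 (2 * PI)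
     (u (- Ci * lam)%C r (2 * PI) - u (- Ci * lam)%C r 0)).
  { apply (is_RInt_derive (V := R_CompleteNormedModule)).
    - intros t _. evar_last; [apply circle_angular_derive|].
      unfold u, m.
      replace (Ci * (- Ci * lam))%C with lam
        by (unfold Ci; destruct lam; unfold Cmult, Copp; simpl; f_equal; ring).
      destruct lam as [p q], (f (polar z r t)) as [a b]; simpl; ring.
    - intros t _. apply (continuous_minus (K := R_AbsRing) (V := R_NormedModule)).
      + apply (continuous_scal_r (K := R_AbsRing) (V := R_NormedModule)).
        apply circle_derive_continuous_t.
      + apply circle_continuous_t. }
  assert (P : polar z r (2 * PI) = polar z r 0).
  { unfold polar. now rewrite cos_2PI, sin_2PI, cos_0, sin_0. }
  unfold u at 2 3 in H. rewrite P, cos_2PI, sin_2PI, cos_0, sin_0, Rminus_diag in H.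
  assert (H2 : is_RInt (fun t => r * m lam r t - u lam r t) 0 (2 * PI) (r * hm lam r - h lam r)).
  { apply (is_RInt_minus (V := R_NormedModule)).
    - apply (is_RInt_scal (V := R_NormedModule)). apply (RInt_correct (V := R_CompleteNormedModule)), Em.
    - apply (RInt_correct (V := R_CompleteNormedModule)), Eu. }
  assert (E1 := is_RInt_unique (V := R_CompleteNormedModule) _ _ _ _ H).
  assert (E2 := is_RInt_unique (V := R_CompleteNormedModule) _ _ _ _ H2).
  simpl in *. lra.
Qed.

Lemma circle_mean_linear (lam : C) (r : R) :
  0 < r -> h lam r = r * (2 * PI * Re (lam * f' z)%C).
Proof.
  intros Hr.
  assert (H0 : hm lam 0 = 2 * PI * Re (lam * f' z)%C).
  { unfold hm. rewrite (RInt_ext _ (fun _ => Re (lam * f' z)%C)).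
    - rewrite RInt_const. unfold scal; simpl. unfold mult; simpl. ring.
    - intros t _. unfold m. do 3 f_equal. unfold polar, Re, Im.
      destruct z; simpl; f_equal; ring. }
  assert (hz : h lam 0 = 0) by (rewrite <- circle_mean_euler; ring).
  rewrite <- H0.
  (* By r h' = h, the quotient h / s has zero derivative for s > 0. *)
  assert (Hq : forall s, 0 < s < r -> h lam s / s = h lam r / r).
  { intros s Hs.
    destruct (MVT_gen (fun x => h lam x / x) s r (fun _ => 0)) as [c [_ Hc]].
    - intros x. rewrite Rmin_left, Rmax_right by lra. intros Hx.
      evar_last.
      + apply (is_derive_div (h lam) (fun x => x)); [apply circle_mean_derive | | lra].
        apply (is_derive_id (K := R_AbsRing)).
      + rewrite <- (circle_mean_euler lam x). unfold one; simpl. field. lra.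
    - intros x. rewrite Rmin_left, Rmax_right by lra. intros Hx.
      apply continuity_pt_div; [ | apply continuity_pt_id | lra].
      apply derivable_continuous_pt. eexists. apply is_derive_Reals, circle_mean_derive.
    - lra. }
  (* Since h vanishes at 0, the constant quotient is a difference quotient at 0 and hence equals h'
     there. *)
  assert (h lam r / r = hm lam 0).
  { apply cond_eq. intros eps Heps.
    assert (D := circle_mean_derive lam 0). apply is_derive_Reals in D.
    destruct (D eps Heps) as [d Hd].
    set (s := Rmin (d / 2) (r / 2)).
    assert (Hs : 0 < s < r).
    { split; [apply Rmin_pos; [generalize (cond_pos d)|]; lra|].
      eapply Rle_lt_trans; [apply Rmin_r|]. lra. }
    specialize (Hd s ltac:(lra)). rewrite Rplus_0_l, hz, Rminus_0_r, Hq in Hd by exact Hs.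
    apply Hd. rewrite Rabs_pos_eq by lra.
    eapply Rle_lt_trans; [apply Rmin_l|]. generalize (cond_pos d). lra. }
  rewrite <- H. field. lra.
Qed.

(** With [lam] rotating f' z onto its modulus, the circle integral equals 2 pi r |f' z|, while its
    integrand is at most M. *)
Lemma Cauchy_derivative_bound (r M : R) :
  0 < r -> (forall w, Cmod (w - z)%C <= r -> Cmod (f w) <= M) -> Cmod (f' z) <= M / r.
Proof.
  intros Hr HM.
  destruct (Cmod_rotate (f' z)) as [lam [Hl HD]].
  assert (H := circle_mean_linear lam r Hr). rewrite HD, re_RtoC in H.
  assert (Hu : Rabs (h lam r) <= (2 * PI - 0) * M).
  { generalize PI_RGT_0; intros Hpi. apply abs_RInt_le_const; [lra| |].
    - apply (ex_RInt_continuous (V := R_CompleteNormedModule)).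
      intros t _. apply circle_continuous_t.
    - intros t _.
      replace (u lam r t) with (Re ((cos t, (- sin t)%R) * lam * f (polar z r t))%C)
        by (unfold u; destruct lam, (f (polar z r t)); simpl; ring).
      eapply Rle_trans; [apply re_le_Cmod|]. rewrite !Cmod_mult, Hl.
      assert (Hc : Cmod (cos t, - sin t) = 1).
      { unfold Cmod; simpl. generalize (sin2_cos2 t). unfold Rsqr. intros Hsc.
        replace (cos t * (cos t * 1) + - sin t * (- sin t * 1))
          with (sin t * sin t + cos t * cos t) by ring. rewrite Hsc. apply sqrt_1. }
      rewrite Hc, !Rmult_1_l. apply HM. rewrite Cmod_polar; lra. }
  apply Rle_div_r; [exact Hr|].
  generalize PI_RGT_0; intros Hpi.
  generalize (Rle_abs (h lam r)). nra.
Qed.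

End CauchyEstimate.

(** Each point of the segment from x to y lies within s of c, so a disc of radius r - s about it is
    available for the derivative bound. *)
Lemma Cauchy_lipschitz (f : C -> C) (c : C) (r s M : R) (x y : C) :
  c1_entire f -> s < r -> (forall w, Cmod (w - c)%C <= r -> Cmod (f w) <= M) ->
  Cmod (x - c)%C <= s -> Cmod (y - c)%C <= s ->
  Cmod (f y - f x)%C <= M / (r - s) * Cmod (y - x)%C.
Proof.
  intros [[f' [Hf Cf]] _] Hsr HM Hx Hy.
  apply (Cmod_mean_value f f'); [exact Hf|].
  intros t Ht. apply (Cauchy_derivative_bound f f'); auto; [lra|].
  intros w Hw. apply HM.
  replace (w - c)%C with ((w - (x + t * (y - x))) + (RtoC (1 - t) * (x - c) + t * (y - c)))%C
    by (rewrite RtoC_minus; ring).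
  eapply Rle_trans; [apply Cmod_triangle|].
  assert (Cmod (RtoC (1 - t) * (x - c) + t * (y - c))%C <= s).
  { eapply Rle_trans; [apply Cmod_triangle|]. rewrite !Cmod_mult, !Cmod_R, !Rabs_pos_eq by lra.
    nra. }
  lra.
Qed.

Lemma c1_entire_lipschitz (f : C -> C) (r : R) :
  c1_entire f -> exists K, 0 < K /\ forall x y, Cmod x <= r -> Cmod y <= r ->
    Cmod (f y - f x)%C <= K * Cmod (y - x)%C.
Proof.
  intros Ef. destruct (proj2 Ef (r + 1)) as [M HM].
  exists (Rmax 1 M). split; [eapply Rlt_le_trans; [|apply Rmax_l]; lra|].
  intros x y Hx Hy.
  assert (E : forall w : C, (w - 0)%C = w) by (intros; ring).
  eapply Rle_trans; [apply (Cauchy_lipschitz f 0 (r + 1) r (Rmax 1 M)); rewrite ?E; auto; try lra|].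
  - intros w. rewrite E. intros Hw. eapply Rle_trans; [apply HM, Hw | apply Rmax_r].
  - right. field. lra.
Qed.

(** * Approximate inverses, cutoffs and limits *)

Lemma pow_le_1 (q : R) (n : nat) : 0 <= q <= 1 -> q ^ n <= 1.
Proof. intros Hq. rewrite <- (pow1 n). now apply pow_incr. Qed.

Lemma pow_lt_eps (q A eps : R) : 0 <= q < 1 -> 0 < eps -> exists n, A * q ^ n <= eps.
Proof.
  intros Hq Heps.
  assert (HA : 0 < Rabs A + 1) by (generalize (Rabs_pos A); lra).
  destruct (pow_lt_1_zero q) with (y := eps / (Rabs A + 1)) as [N HN].
  - rewrite Rabs_pos_eq; lra.
  - now apply Rdiv_lt_0_compat.
  - exists N. specialize (HN N (Nat.le_refl N)).
    apply Rlt_div_r in HN; [|exact HA].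
    assert (0 <= q ^ N) by (apply pow_le; lra).
    rewrite Rabs_pos_eq in HN by assumption.
    generalize (Rle_abs A). nra.
Qed.

(* Fixed point iteration: the solution x of F x = w is the fixed point of
   x |-> w - d x with d = F - id, a contraction by the Cauchy estimate for d.
   The iterates started at x = w are entire in w. *)
Lemma approximate_inverse (F : C -> C) (r s e eta : R) :
  c1_entire F -> s < r -> (forall z, Cmod z <= r -> Cmod (F z - z)%C <= e) ->
  0 <= e <= (r - s) / 4 -> 0 < eta ->
  exists T, c1_entire T /\ forall z, Cmod z <= s -> Cmod (T (F z) - z)%C <= eta.
Proof.
  intros EF Hsr HF He Heta.
  assert (E0 : forall w : C, (w - 0)%C = w) by (intros; ring).
  set (d := fun z => (F z - z)%C).
  assert (Ed : c1_entire d) by (apply c1_entire_minus; [exact EF | exact c1_entire_id]).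
  (* At radius (r + s) / 2 the remaining room is (r - s) / 2, so e <= (r - s) / 4 gives the
     contraction factor 1/2. The iterates stay in that disc because s + e <= (r + s) / 2. *)
  assert (HL : forall x y, Cmod x <= (r + s) / 2 -> Cmod y <= (r + s) / 2 ->
     Cmod (d y - d x)%C <= 1 / 2 * Cmod (y - x)%C).
  { intros x y Hx Hy.
    eapply Rle_trans; [apply (Cauchy_lipschitz d 0 r ((r + s) / 2) e)|]; rewrite ?E0; auto; try lra.
    - intros w. rewrite E0. apply HF.
    - apply Rmult_le_compat_r; [apply Cmod_ge_0|]. apply Rle_div_l; lra. }
  set (inv := fix inv k w := match k with O => w | S k => (w - d (inv k w))%C end).
  assert (ES : forall k, c1_entire (inv k)).
  { induction k as [|k IH]; simpl; [exact c1_entire_id|].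
    apply (c1_entire_minus (fun w => w)); [exact c1_entire_id|].
    now apply (c1_entire_comp d). }
  assert (HS : forall k z, Cmod z <= s -> Cmod (inv k (F z) - z)%C <= e * (1 / 2) ^ k).
  { induction k as [|k IH]; intros z Hz.
    - simpl. rewrite Rmult_1_r. apply HF. lra.
    - simpl. specialize (IH z Hz).
      assert (e * (1 / 2) ^ k <= e).
      { rewrite <- (Rmult_1_r e) at 2. apply Rmult_le_compat_l; [lra|].
        apply pow_le_1. lra. }
      assert (Cmod (inv k (F z)) <= (r + s) / 2).
      { eapply Rle_trans; [apply (Cmod_le_minus _ z)|]. lra. }
      replace (F z - d (inv k (F z)) - z)%C with (d z - d (inv k (F z)))%C by (unfold d; ring).
      eapply Rle_trans; [apply HL; lra|]. rewrite Cmod_minus_sym. lra. }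
  destruct (pow_lt_eps (1 / 2) e eta) as [k Hk]; [lra | exact Heta |].
  exists (inv k). split; [apply ES|]. intros z Hz. eapply Rle_trans; [now apply HS | exact Hk].
Qed.

(* 0 and 1 are superattracting fixed points of 3 y^2 - 2 y^3. *)
Lemma cutoff (alpha : R) :
  0 < alpha -> exists chi, c1_entire chi /\
    (forall y, Cmod y <= 1 / 4 -> Cmod (chi y) <= alpha) /\
    (forall y, Cmod (1 - y)%C <= 1 / 4 -> Cmod (1 - chi y)%C <= alpha).
Proof.
  intros Ha.
  set (q := fun y : C => (y * y * (3 - 2 * y))%C).
  assert (Eq : c1_entire q).
  { apply (c1_entire_mult (fun y => y * y)%C).
    - apply c1_entire_mult; exact c1_entire_id.
    - apply c1_entire_minus; [apply c1_entire_const|].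
      apply (c1_entire_mult (fun _ => 2)%C); [apply c1_entire_const | exact c1_entire_id]. }
  assert (Hq : forall y, Cmod y <= 1 / 4 -> Cmod (q y) <= 7 / 8 * Cmod y).
  { intros y Hy. unfold q. rewrite !Cmod_mult.
    assert (Cmod (3 - 2 * y)%C <= 3 + 2 * Cmod y).
    { eapply Rle_trans; [apply Cmod_minus_le|].
      rewrite Cmod_mult, !Cmod_R, !Rabs_pos_eq by lra. lra. }
    generalize (Cmod_ge_0 y) (Cmod_ge_0 (3 - 2 * y)%C). intros.
    assert (Cmod y * Cmod (3 - 2 * y)%C <= 7 / 8) by nra. nra. }
  assert (Hsym : forall y, (1 - q y)%C = q (1 - y)%C) by (intros; unfold q; ring).
  set (chi := fun k y => Nat.iter k q y).
  assert (Ec : forall k, c1_entire (chi k)).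
  { induction k as [|k IH]; [exact c1_entire_id|]. now apply (c1_entire_comp q). }
  assert (H0 : forall k y, Cmod y <= 1 / 4 -> Cmod (chi k y) <= 1 / 4 * (7 / 8) ^ k).
  { induction k as [|k IH]; intros y Hy; [simpl; lra|].
    change (chi (S k) y) with (q (chi k y)). specialize (IH y Hy).
    assert ((7 / 8) ^ k <= 1) by (apply pow_le_1; lra).
    simpl. eapply Rle_trans; [apply Hq; lra|]. lra. }
  assert (H1 : forall k y, (1 - chi k y)%C = chi k (1 - y)%C).
  { induction k as [|k IH]; intros y; [reflexivity|].
    change (chi (S k) y) with (q (chi k y)). rewrite Hsym, IH. reflexivity. }
  destruct (pow_lt_eps (7 / 8) (1 / 4) alpha) as [k Hk]; [lra | exact Ha |].
  exists (chi k). split; [apply Ec|]. split; intros y Hy; rewrite ?H1;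
    (eapply Rle_trans; [now apply H0 | exact Hk]).
Qed.

Lemma C_complete (v : nat -> C) :
  (forall eps, 0 < eps -> exists N, forall n m, (N <= n)%nat -> (N <= m)%nat ->
     Cmod (v n - v m)%C <= eps) ->
  exists l, forall eps, 0 < eps -> exists N, forall n, (N <= n)%nat -> Cmod (v n - l)%C <= eps.
Proof.
  intros H.
  assert (A : forall p : C -> R, (forall a b, Rabs (p a - p b) <= Cmod (a - b)%C) ->
    { l | Un_cv (fun n => p (v n)) l }).
  { intros p Hp. apply Rcomplete.R_complete. intros eps Heps.
    destruct (H (eps / 2)) as [N HN]; [lra|].
    exists N. intros n m Hn Hm. unfold Rdist.
    eapply Rle_lt_trans; [apply Hp|]. specialize (HN n m Hn Hm). lra. }
  destruct (A Re) as [a Ha]; [intros x y; apply (re_le_Cmod (x - y)%C)|].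
  destruct (A Im) as [b Hb]; [intros x y; apply (im_le_Cmod (x - y)%C)|].
  exists (a, b). intros eps Heps.
  destruct (Ha (eps / 2)) as [N1 H1]; [lra|]. destruct (Hb (eps / 2)) as [N2 H2]; [lra|].
  exists (max N1 N2). intros n Hn.
  specialize (H1 n ltac:(lia)). specialize (H2 n ltac:(lia)). unfold Rdist in *.
  eapply Rle_trans; [apply Cmod_re_im|]. rewrite re_minus.
  change (Im (v n - (a, b))%C) with (Im (v n) - b). change (Re (a, b)) with a. lra.
Qed.

Lemma cderiv_minus (f g : C -> C) (z a b : C) :
  cderiv f z a -> cderiv g z b -> cderiv (fun w => f w - g w)%C z (a - b)%C.
Proof.
  intros Hf Hg eps Heps.
  destruct (Hf (eps/2)) as [d [Hd H1]]; [lra|].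
  destruct (Hg (eps/2)) as [d' [Hd' H2]]; [lra|].
  exists (Rmin d d'). split; [now apply Rmin_pos|]. intros h Hh.
  specialize (H1 h (Rlt_le_trans _ _ _ Hh (Rmin_l _ _))).
  specialize (H2 h (Rlt_le_trans _ _ _ Hh (Rmin_r _ _))).
  replace (f (z + h) - g (z + h) - (f z - g z) - (a - b) * h)%C
    with ((f (z + h) - f z - a * h) - (g (z + h) - g z - b * h))%C by ring.
  eapply Rle_trans; [apply Cmod_minus_le|]. lra.
Qed.

(** Cauchy's estimate for f_n - f_m makes the derivatives at z a Cauchy sequence, and their limit is
    the derivative of g. *)
Lemma Weierstrass_limit (f : nat -> C -> C) (g : C -> C) (z : C) :
  (forall n, c1_entire (f n)) ->
  (forall r eps, 0 < eps -> exists N, forall n, (N <= n)%nat ->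
     forall w, Cmod w <= r -> Cmod (f n w - g w)%C <= eps) ->
  exists l, cderiv g z l.
Proof.
  intros Ef Hlim.
  set (f' := fun n => proj1_sig (constructive_indefinite_description _ (proj1 (Ef n)))).
  assert (Hf' : forall n, (forall w, cderiv (f n) w (f' n w)) /\ ccont (f' n))
    by (intros n; exact (proj2_sig (constructive_indefinite_description _ (proj1 (Ef n))))).
  assert (Hcl : forall eps, 0 < eps -> exists N, forall n m, (N <= n)%nat -> (N <= m)%nat ->
     forall w, Cmod (w - z)%C <= 2 -> Cmod (f n w - f m w)%C <= eps).
  { intros eps Heps. destruct (Hlim (Cmod z + 2) (eps / 2)) as [N HN]; [lra|].
    exists N. intros n m Hn Hm w Hw.
    assert (Cmod w <= Cmod z + 2) by (generalize (Cmod_le_minus w z); lra).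
    eapply Rle_trans; [apply (Cmod_tri _ _ (g w))|].
    rewrite (Cmod_minus_sym (g w)). generalize (HN n Hn w H) (HN m Hm w H). lra. }
  destruct (C_complete (fun n => f' n z)) as [l Hl].
  { intros eps Heps. destruct (Hcl eps Heps) as [N HN]. exists N. intros n m Hn Hm.
    replace eps with (eps / 1) by field.
    apply (Cauchy_derivative_bound (fun w => f n w - f m w)%C (fun w => f' n w - f' m w)%C z).
    - intros w. apply cderiv_minus; apply Hf'.
    - assert (A := ccont_mult (fun _ => (- (1))%C) (f' m) (ccont_const _) (proj2 (Hf' m))).
      assert (B := ccont_plus _ _ (proj2 (Hf' n)) A). intros w e He.
      destruct (B w e He) as [d [Hd HB]]. exists d. split; [exact Hd|]. intros h Hh.
      specialize (HB h Hh).
      replace (f' n (w + h) - f' m (w + h) - (f' n w - f' m w))%C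
        with (f' n (w + h) + - (1) * f' m (w + h) - (f' n w + - (1) * f' m w))%C by ring.
      exact HB.
    - lra.
    - intros w Hw. apply HN; auto; lra. }
  exists l. intros eps Heps.
  destruct (Hcl (eps / 4)) as [N1 HN1]; [lra|].
  destruct (Hl (eps / 4)) as [N2 HN2]; [lra|].
  set (N := max N1 N2).
  assert (Hd : cderiv (f N) z (f' N z)) by apply Hf'.
  destruct (Hd (eps / 4)) as [d [Hd0 HdN]]; [lra|].
  exists (Rmin 1 d). split; [apply Rmin_pos; lra|]. intros h Hh.
  specialize (HdN h (Rlt_le_trans _ _ _ Hh (Rmin_r _ _))).
  assert (Hh1 := Rlt_le_trans _ _ _ Hh (Rmin_l _ _)).
  specialize (HN2 N ltac:(unfold N; lia)).
  (* The differences f_m - f_N are at most eps / 4 on the disc of radius 2 and hence eps /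
     4-Lipschitz on that of radius 1, uniformly in m; letting m tend to infinity replaces f_m by
     g. *)
  assert (Hm : Cmod ((g (z + h) - f N (z + h)) - (g z - f N z))%C <= eps / 4 * Cmod h).
  { apply le_epsilon. intros e He.
    destruct (Hlim (Cmod z + 2) (e / 2)) as [N3 HN3]; [lra|].
    set (m := max N N3).
    assert (A := Cauchy_lipschitz (fun w => f m w - f N w)%C z 2 1 (eps / 4) z (z + h)%C).
    cbv beta in A.
    replace (z + h - z)%C with h in A by ring.
    replace (z - z)%C with (RtoC 0) in A by ring.
    rewrite Cmod_0 in A. replace (eps / 4 / (2 - 1)) with (eps / 4) in A by field.
    assert (A1 := A ltac:(now apply c1_entire_minus) ltac:(lra)
       ltac:(intros w Hw; apply HN1; unfold m, N in *; (lia || lra)) ltac:(lra) ltac:(lra)).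
    assert (B1 := HN3 m ltac:(unfold m; lia) z ltac:(lra)).
    assert (B2 := HN3 m ltac:(unfold m; lia) (z + h)%C
       ltac:(eapply Rle_trans; [apply Cmod_triangle | lra])).
    replace (g (z + h) - f N (z + h) - (g z - f N z))%C
      with ((f m (z + h) - f N (z + h) - (f m z - f N z))
        + ((f m z - g z) - (f m (z + h) - g (z + h))))%C by ring.
    eapply Rle_trans; [apply Cmod_triangle|].
    generalize (Cmod_minus_le (f m z - g z)%C (f m (z + h) - g (z + h))%C). lra. }
  replace (g (z + h) - g z - l * h)%C
    with ((g (z + h) - f N (z + h) - (g z - f N z))
      + ((f N (z + h) - f N z - f' N z * h) + (f' N z - l) * h))%C by ring.
  eapply Rle_trans; [apply Cmod_triangle|].
  assert (B := Cmod_triangle (f N (z + h) - f N z - f' N z * h)%C ((f' N z - l) * h)%C).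
  rewrite (Cmod_mult (f' N z - l)%C) in B.
  generalize (Cmod_ge_0 h). intros.
  assert (Cmod (f' N z - l)%C * Cmod h <= eps / 4 * Cmod h) by (apply Rmult_le_compat_r; lra).
  assert (0 <= eps * Cmod h) by (apply Rmult_le_pos; lra). lra.
Qed.

(** * Iteration of [E o phi] *)

(** The factor 100 places [E 0] far from the unit disc, so small values of phi around [E 0] do not
    interfere with its values on the disc. *)
Definition E (z : C) : C := (100 * Cexp z)%C.

Definition giter (phi : C -> C) (n : nat) (u : C) : C := Nat.iter n (fun w => E (phi w)) u.

Lemma giter_S (phi : C -> C) (n : nat) (u : C) : giter phi (S n) u = E (phi (giter phi n u)).
Proof. reflexivity. Qed.

Lemma c1_entire_E : c1_entire E.
Proof. apply c1_entire_mult; [apply c1_entire_const | exact c1_entire_Cexp]. Qed.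

Lemma c1_entire_giter (phi : C -> C) (n : nat) : c1_entire phi -> c1_entire (giter phi n).
Proof.
  intros H. induction n as [|n IH]; [exact c1_entire_id|].
  apply (c1_entire_comp E); [exact c1_entire_E|]. now apply (c1_entire_comp phi).
Qed.

(** The margin 1 around the orbits keeps perturbed orbits inside [D], the only place where psi is
    compared with phi. An error e of one iterate becomes at most L' (delta + L e) in the next, with
    Lipschitz constants L of phi and L' of [E]. *)
Lemma giter_perturb (phi : C -> C) (D K : C -> Prop) (r : R) (m : nat) :
  c1_entire phi -> (forall u, D u -> Cmod u <= r) ->
  (forall z j, K z -> (j < m)%nat -> forall u, Cmod (u - giter phi j z)%C <= 1 -> D u) ->
  forall eps, 0 < eps -> exists delta, 0 < delta /\
    forall psi, (forall u, D u -> Cmod (psi u - phi u)%C <= delta) ->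
    forall z j, K z -> (j <= m)%nat -> Cmod (giter psi j z - giter phi j z)%C <= eps.
Proof.
  intros Ep HD. induction m as [|m IH]; intros HK eps Heps.
  - exists 1. split; [lra|]. intros psi _ z j _ Hj. replace j with O by lia.
    change (Cmod (z - z)%C <= eps). replace (z - z)%C with (RtoC 0) by ring. rewrite Cmod_0. lra.
  - destruct (c1_entire_lipschitz phi r Ep) as [L [HL HLip]].
    destruct (proj2 Ep r) as [M HM].
    destruct (c1_entire_lipschitz E (M + 1) c1_entire_E) as [L' [HL' HLip']].
    set (e := Rmin (Rmin eps 1) (eps / (2 * L' * L))).
    assert (He : 0 < e).
    { repeat apply Rmin_pos; try lra. apply Rdiv_lt_0_compat; nra. }
    assert (He1 : e <= eps) by (eapply Rle_trans; [apply Rmin_l | apply Rmin_l]).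
    assert (He2 : e <= 1) by (eapply Rle_trans; [apply Rmin_l | apply Rmin_r]).
    assert (He3 : e * (2 * L' * L) <= eps) by (apply Rle_div_r; [nra | apply Rmin_r]).
    destruct (IH ltac:(intros z j Hz Hj; apply HK; [exact Hz | lia]) e He) as [d [Hd IHd]].
    set (d' := Rmin (Rmin d 1) (eps / (2 * L'))).
    assert (Hd' : 0 < d').
    { repeat apply Rmin_pos; try lra. apply Rdiv_lt_0_compat; lra. }
    assert (Hd1 : d' <= d) by (eapply Rle_trans; [apply Rmin_l | apply Rmin_l]).
    assert (Hd2 : d' <= 1) by (eapply Rle_trans; [apply Rmin_l | apply Rmin_r]).
    assert (Hd3 : d' * (2 * L') <= eps) by (apply Rle_div_r; [lra | apply Rmin_r]).
    exists d'. split; [exact Hd'|]. intros psi Hpsi z j Hz Hj.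
    assert (IHz : forall i, (i <= m)%nat -> Cmod (giter psi i z - giter phi i z)%C <= e).
    { intros i Hi. apply IHd; auto. intros u Hu. generalize (Hpsi u Hu); lra. }
    destruct (Nat.eq_dec j (S m)) as [->|Hne].
    2:{ generalize (IHz j ltac:(lia)); lra. }
    rewrite !giter_S. specialize (IHz m (Nat.le_refl m)).
    set (u := giter phi m z) in *. set (u' := giter psi m z) in *.
    assert (Du' : D u') by (apply (HK z m); auto; fold u; lra).
    assert (Du : D u).
    { apply (HK z m); auto. fold u. replace (u - u)%C with (RtoC 0) by ring. rewrite Cmod_0; lra. }
    assert (A1 := Hpsi u' Du').
    assert (A2 := HLip u u' (HD _ Du) (HD _ Du')).
    assert (A3 := HM u (HD _ Du)). assert (A4 := HM u' (HD _ Du')).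
    assert (A5 : Cmod (psi u') <= M + 1).
    { eapply Rle_trans; [apply (Cmod_le_minus _ (phi u'))|]. lra. }
    eapply Rle_trans; [apply HLip'; lra|].
    assert (Cmod (psi u' - phi u)%C <= d' + L * e).
    { eapply Rle_trans; [apply (Cmod_tri _ _ (phi u'))|].
      assert (L * Cmod (u' - u)%C <= L * e) by (apply Rmult_le_compat_l; lra). lra. }
    assert (L' * Cmod (psi u' - phi u)%C <= L' * (d' + L * e)) by (apply Rmult_le_compat_l; lra).
    nra.
Qed.

(** At |v| = 1/50 the bound is 5, the radius of the trap. *)
Lemma E_near_100 (v : C) : Cmod v <= 1 / 50 -> Cmod (E v - 100)%C <= 250 * Cmod v.
Proof.
  intros H. unfold E. replace (100 * Cexp v - 100)%C with (100 * (Cexp v - 1))%C by ring.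
  rewrite Cmod_mult, Cmod_R, Rabs_pos_eq by lra.
  generalize (Cexp_minus_1 v ltac:(lra)). lra.
Qed.

(** With y = b + v one has E y = a e^v, whose linear part a + a v is within k of a + z. As |v| <= 3
    / a, the quadratic remainder is at most a * 3 (3 / a)^2 = 27 / a. *)
Lemma E_near_affine (a b k : R) (y z : C) :
  100 <= a -> 100 * exp b = a -> Cmod z <= 2 -> 0 <= k <= 1 ->
  Cmod (y - (b + z / a))%C <= k / a -> Cmod (E y - a - z)%C <= k + 27 / a.
Proof.
  intros Ha Hb Hz Hk Hy.
  assert (Ha' : RtoC a <> 0) by (intros Q; apply RtoC_inj in Q; lra).
  set (v := (y - b)%C).
  assert (Hv1 : Cmod (a * v - z)%C <= k).
  { replace (a * v - z)%C with (a * (y - (b + z / a)))%C by (unfold v; field; exact Ha').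
    rewrite Cmod_mult, Cmod_R, Rabs_pos_eq by lra.
    replace k with (a * (k / a)) by (field; lra). apply Rmult_le_compat_l; lra. }
  assert (Hv2 : a * Cmod v <= 3).
  { replace (a * Cmod v) with (Cmod (a * v)%C) by (rewrite Cmod_mult, Cmod_R, Rabs_pos_eq; lra).
    eapply Rle_trans; [apply (Cmod_le_minus _ z)|]. lra. }
  assert (Hv3 : Cmod v <= 3 / a) by (apply Rle_div_r; lra).
  assert (3 / a <= 1 / 2) by (apply Rle_div_l; lra).
  assert (HE : E y = (a * Cexp v)%C).
  { unfold E. replace y with (b + v)%C by (unfold v; ring).
    rewrite Cexp_plus, Cexp_RtoC, <- Hb, RtoC_mult. ring. }
  rewrite HE.
  replace (a * Cexp v - a - z)%C with ((a * v - z) + a * (Cexp v - 1 - v))%C by ring.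
  eapply Rle_trans; [apply Cmod_triangle|]. apply Rplus_le_compat; [exact Hv1|].
  rewrite Cmod_mult, Cmod_R, Rabs_pos_eq by lra.
  generalize (Cexp_taylor1 v ltac:(lra)) (Cmod_ge_0 v). intros Q1 Q2.
  apply Rle_trans with (a * (3 * Cmod v ^ 2)); [apply Rmult_le_compat_l; lra|].
  replace (27 / a) with (a * (3 * (3 / a) ^ 2)) by (field; lra).
  apply Rmult_le_compat_l; [lra|]. apply Rmult_le_compat_l; [lra|]. apply pow_incr. lra.
Qed.

Definition cis (t : R) : C := Cexp (0, t).

Lemma Cmod_cis (t : R) : Cmod (cis t) = 1.
Proof. unfold cis. rewrite Cmod_Cexp. apply exp_0. Qed.

Lemma cis_pow (t : R) (n : nat) : (cis t ^ n)%C = cis (INR n * t).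
Proof.
  induction n as [|n IH].
  - unfold cis, Cexp, Re, Im. simpl. rewrite Rmult_0_l, exp_0, cos_0, sin_0.
    unfold RtoC. f_equal; ring.
  - rewrite S_INR. change (cis t ^ S n)%C with (cis t * cis t ^ n)%C. rewrite IH.
    unfold cis. rewrite <- Cexp_plus. f_equal. unfold Cplus; simpl. f_equal; ring.
Qed.

(** The solutions are the odd multiples of pi / n, and each t is within pi / n of one of them. *)
Lemma roots_of_minus_one_dense (n : nat) (t : R) :
  (1 <= n)%nat -> exists t', Rabs (t' - t) <= 4 / INR n /\ (cis t' ^ n)%C = (- (1))%C.
Proof.
  intros Hn. assert (HN : 0 < INR n) by (apply lt_0_INR; lia).
  generalize PI_RGT_0 PI_4; intros Hpi Hpi4.
  set (x := INR n * t / (2 * PI)).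
  destruct (archimed x) as [H1 H2]. set (k := (up x - 1)%Z).
  assert (Hk : 0 <= x - IZR k <= 1) by (unfold k; rewrite minus_IZR; lra).
  exists ((2 * IZR k + 1) * PI / INR n). split.
  - replace ((2 * IZR k + 1) * PI / INR n - t) with ((2 * PI * (1 / 2 - (x - IZR k))) / INR n)
      by (unfold x; field; split; lra).
    rewrite Rabs_div, (Rabs_pos_eq (INR n)) by lra.
    apply Rmult_le_compat_r; [apply Rlt_le, Rinv_0_lt_compat, HN|].
    rewrite Rabs_mult, (Rabs_pos_eq (2 * PI)) by lra.
    assert (Rabs (1 / 2 - (x - IZR k)) <= 1 / 2) by (apply Rabs_le; lra).
    generalize (Rabs_pos (1 / 2 - (x - IZR k))). nra.
  - rewrite cis_pow.
    replace (INR n * ((2 * IZR k + 1) * PI / INR n)) with (PI + 2 * IZR k * PI) by (field; lra).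
    unfold cis, Cexp, Re, Im; simpl. rewrite exp_0.
    rewrite cos_plus, sin_plus, cos_PI, sin_PI.
    assert (Hs : sin (2 * IZR k * PI) = 0).
    { apply sin_eq_0_1. exists (2 * k)%Z. now rewrite mult_IZR. }
    assert (Hc : cos (2 * IZR k * PI) = 1).
    { replace (2 * IZR k * PI) with (2 * (IZR k * PI)) by ring. rewrite cos_2a_sin.
      rewrite (sin_eq_0_1 (IZR k * PI)); [ring | now exists k]. }
    rewrite Hs, Hc. unfold Copp, RtoC; simpl. f_equal; ring.
Qed.

(** * The inductive construction *)

Definition half_pow (n : nat) : R := (1 / 2) ^ n.
(** The radii satisfy [rho n] > [sigma n] > [rho (S n)] > 1: stage n controls the disc of radius
    [rho n], its map is inverted up to [sigma n], and the points trapped by the next stage lie at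
    [sigma n], outside the next disc. *)
Definition rho (n : nat) : R := 1 + half_pow n.
Definition sigma (n : nat) : R := 1 + 3 / 4 * half_pow n.
(** A quarter of [rho n - sigma n], the error that [approximate_inverse] accepts. *)
Definition tol (n : nat) : R := half_pow n / 16.
(** The value at 0 reflects that the zeroth iterate is the identity. *)
Definition center (n : nat) : R := match n with O => 0 | S _ => 10000 ^ n end.
Definition dom_center (n : nat) : R := match n with O => 100 | S _ => 0 end.
Definition dom_radius (n : nat) : R := match n with O => 5 | S _ => 10000 ^ n / 4 end.
(* dom 0 is the trap D(100, 5), which E maps into from D(0, 1/50); it is disjoint
   from the closed unit disc, where stage 1 prescribes a different value. *)
Definition dom (n : nat) (u : C) : Prop := Cmod (u - dom_center n)%C <= dom_radius n.

Lemma half_pow_pos (n : nat) : 0 < half_pow n.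
Proof. apply pow_lt. lra. Qed.

Lemma half_pow_le_1 (n : nat) : half_pow n <= 1.
Proof. apply pow_le_1. lra. Qed.

Lemma half_pow_S (n : nat) : half_pow (S n) = half_pow n / 2.
Proof. unfold half_pow. simpl. lra. Qed.

Lemma center_S (n : nat) : center (S n) = 10000 * 10000 ^ n.
Proof. reflexivity. Qed.

Lemma pow_10000_ge_1 (n : nat) : 1 <= 10000 ^ n.
Proof. apply pow_R1_Rle. lra. Qed.

(** Centers outgrow the decay of the tolerances: [tol (S n) * center (S n)] is at least 300, which
    absorbs the error 27 / a of [E_near_affine]. *)
Lemma half_pow_center (n : nat) : 5000 <= half_pow (S n) * center (S n).
Proof.
  unfold half_pow. rewrite center_S. change (10000 * 10000 ^ n) with (10000 ^ S n).
  rewrite <- Rpow_mult_distr. replace (1 / 2 * 10000) with 5000 by field.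
  simpl. assert (1 <= 5000 ^ n) by (apply pow_R1_Rle; lra). lra.
Qed.

Lemma center_nonneg (n : nat) : 0 <= center n.
Proof. destruct n; simpl; [lra|]. generalize (pow_10000_ge_1 n); lra. Qed.

(** The 4 accommodates the disc of radius 3 about [center n] and, for orbit points within 2 + 1/16
    of it, the unit margin of [giter_perturb]. *)
Lemma center_dom_radius (n : nat) : center n + 4 <= dom_radius (S n).
Proof. destruct n; simpl; [lra|]. generalize (pow_10000_ge_1 n); lra. Qed.

Lemma dom_radius_mono (n : nat) : dom_radius n <= dom_radius (S n).
Proof. destruct n; simpl; [lra|]. generalize (pow_10000_ge_1 n); lra. Qed.

Lemma dom_S_iff (n : nat) (u : C) : dom (S n) u <-> Cmod u <= dom_radius (S n).
Proof. unfold dom. simpl (dom_center (S n)). replace (u - 0)%C with u by ring. tauto. Qed.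

Lemma dom_bound (n : nat) (u : C) : dom n u -> Cmod u <= dom_radius (S n).
Proof.
  intros Hu. destruct n as [|n].
  - unfold dom in Hu. change (dom_radius 0) with 5 in Hu. change (dom_center 0) with 100 in Hu.
    generalize (Cmod_le_minus u 100) (center_dom_radius 0).
    rewrite (Cmod_R 100), Rabs_pos_eq by lra.
    unfold dom_radius. simpl (10000 ^ 1). lra.
  - apply (proj1 (dom_S_iff n u)) in Hu. generalize (dom_radius_mono (S n)). lra.
Qed.

(** The affine map taking [dom_center n] to 0 and [center n] to 1 shrinks both [dom n] and the disc
    of radius 3 about [center n] to radius at most 1/4, as [cutoff] requires. *)
Lemma dom_sep (n : nat) :
  100 <= Rabs (center n - dom_center n) /\ dom_radius n <= Rabs (center n - dom_center n) / 4.
Proof.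
  destruct n as [|n]; simpl.
  - rewrite Rabs_left by lra. lra.
  - rewrite Rminus_0_r, Rabs_pos_eq; generalize (pow_10000_ge_1 n); lra.
Qed.

(** The second clause is the margin hypothesis of [giter_perturb]. The third sets the trap at n = 0;
    afterwards it puts into the trap a set of points on |u| = [sigma k] whose gaps shrink with n. *)
Definition stage (n : nat) (psi : C -> C) : Prop :=
  (forall z, Cmod z <= rho n -> Cmod (giter psi n z - center n - z)%C <= tol n) /\
  (forall j z, (j < n)%nat -> Cmod z <= rho n -> Cmod (giter psi j z) <= dom_radius n - 1) /\
  match n with
  | O => forall u, Cmod (u - 100)%C <= 5 -> Cmod (psi u) <= 1 / 50
  | S k => forall t, exists t', Rabs (t' - t) <= half_pow n /\
             Cmod (giter psi n (sigma k * cis t') - 100)%C <= 5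
  end.

(** Closeness is required on [dom n] only, so later stages may change phi freely elsewhere. *)
Definition stable_stage (n : nat) (phi : C -> C) (delta : R) : Prop :=
  c1_entire phi /\ 0 < delta /\
  forall psi, (forall u, dom n u -> Cmod (psi u - phi u)%C <= delta) -> stage n psi.

Lemma stage_orbit_bound (n : nat) (psi : C -> C) (j : nat) (z : C) :
  stage n psi -> (j < S n)%nat -> Cmod z <= rho n -> Cmod (giter psi j z) <= dom_radius (S n) - 1.
Proof.
  intros [Ha [Hb _]] Hj Hz. destruct (Nat.eq_dec j n) as [->|Hne].
  - generalize (Ha z Hz) (center_dom_radius n) (half_pow_le_1 n) (half_pow_pos n). unfold rho, tol in *. intros.
    assert (Cmod (giter psi n z) <= Cmod (giter psi n z - center n - z)%C + Cmod (center n + z)%C).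
    { replace (giter psi n z - center n - z)%C with (giter psi n z - (center n + z))%C by ring.
      apply Cmod_le_minus. }
    generalize (Cmod_triangle (center n) z). rewrite Cmod_R, Rabs_pos_eq by apply center_nonneg.
    intros. lra.
  - generalize (Hb j z ltac:(lia) Hz) (dom_radius_mono n). lra.
Qed.

Lemma stage_near_center (n : nat) (psi : C -> C) (z : C) :
  stage n psi -> Cmod z <= rho n -> Cmod (giter psi n z - center n)%C <= 2 + 1 / 16.
Proof.
  intros [Ha _] Hz. generalize (Ha z Hz) (half_pow_le_1 n). unfold rho, tol in *. intros.
  eapply Rle_trans; [apply (Cmod_le_minus _ z)|]. lra.
Qed.

Lemma stage_inverse (n : nat) (phi : C -> C) (eta : R) :
  c1_entire phi -> stage n phi -> 0 < eta ->
  exists T, c1_entire T /\ forall z, Cmod z <= sigma n -> Cmod (T (giter phi n z) - z)%C <= eta.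
Proof.
  intros Ep [Ha _] Heta. assert (Hp := half_pow_pos n).
  destruct (approximate_inverse (fun z => giter phi n z - center n)%C (rho n) (sigma n) (tol n) eta)
    as [T [ET HT]].
  - apply c1_entire_minus; [now apply c1_entire_giter | apply c1_entire_const].
  - unfold rho, sigma. lra.
  - exact Ha.
  - unfold rho, sigma, tol. lra.
  - exact Heta.
  - exists (fun u => T (u - center n)%C). split; [|exact HT].
    apply (c1_entire_comp T); [exact ET|].
    apply c1_entire_minus; [exact c1_entire_id | apply c1_entire_const].
Qed.

(** An entire cutoff is never exactly 0 or 1 on a disc without being constant, so its error is
    divided by a bound of tau - phi on the disc of radius [dom_radius (S n)], which contains both
    regions. *)
Lemma stage_patch (n : nat) (phi tau : C -> C) (alpha : R) :
  c1_entire phi -> c1_entire tau -> 0 < alpha ->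
  exists phi', c1_entire phi' /\
    (forall u, dom n u -> Cmod (phi' u - phi u)%C <= alpha) /\
    (forall u, Cmod (u - center n)%C <= 3 -> Cmod (phi' u - tau u)%C <= alpha).
Proof.
  intros Ep Et Ha.
  set (d := fun u => (tau u - phi u)%C).
  assert (Ed : c1_entire d) by now apply c1_entire_minus.
  destruct (proj2 Ed (dom_radius (S n))) as [M HM].
  set (M' := Rmax 1 M).
  assert (HM' : 1 <= M') by apply Rmax_l.
  assert (HdM : forall u, Cmod u <= dom_radius (S n) -> Cmod (d u) <= M').
  { intros u Hu. eapply Rle_trans; [now apply HM | apply Rmax_r]. }
  destruct (cutoff (alpha / M')) as [X [EX [X0 X1]]]; [apply Rdiv_lt_0_compat; lra|].
  destruct (dom_sep n) as [Hs1 Hs2].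
  set (s := (center n - dom_center n)%R) in *.
  assert (Hs0 : RtoC s <> 0).
  { intros Q. apply RtoC_inj in Q. rewrite Q, Rabs_R0 in Hs1. lra. }
  set (Y := fun u : C => ((u - dom_center n) / s)%C).
  assert (EY : c1_entire Y).
  { apply (c1_entire_mult (fun u => u - dom_center n)%C (fun _ => / RtoC s)%C).
    - apply c1_entire_minus; [exact c1_entire_id | apply c1_entire_const].
    - apply c1_entire_const. }
  assert (HX : forall x, Cmod x <= alpha / M' -> forall u, Cmod u <= dom_radius (S n) ->
    Cmod (x * d u)%C <= alpha).
  { intros x Hx u Hu. rewrite Cmod_mult. replace alpha with (alpha / M' * M') by (field; lra).
    apply Rmult_le_compat; auto using Cmod_ge_0. }
  exists (fun u => phi u + X (Y u) * d u)%C. split; [|split].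
  - apply c1_entire_plus; [exact Ep|]. apply (c1_entire_mult (fun u => X (Y u))); [|exact Ed].
    now apply (c1_entire_comp X).
  - intros u Hu. replace (phi u + X (Y u) * d u - phi u)%C with (X (Y u) * d u)%C by ring.
    apply HX; [|now apply dom_bound]. apply X0. unfold Y.
    rewrite Cmod_div, Cmod_R by exact Hs0. apply Rle_div_l; [lra|].
    unfold dom in Hu. lra.
  - intros u Hu.
    replace (phi u + X (Y u) * d u - tau u)%C with (- ((1 - X (Y u)) * d u))%C
      by (unfold d; ring).
    rewrite Cmod_opp. apply HX.
    + apply X1. unfold Y.
      replace (1 - (u - dom_center n) / s)%C with (- (u - center n) / s)%C
        by (unfold s in *; rewrite RtoC_minus in *; field; exact Hs0).
      rewrite Cmod_div, Cmod_opp, Cmod_R by exact Hs0. apply Rle_div_l; lra.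
    + eapply Rle_trans; [apply (Cmod_le_minus _ (center n))|].
      rewrite Cmod_R, Rabs_pos_eq by apply center_nonneg. generalize (center_dom_radius n); lra.
Qed.

Lemma center_S_ge (n : nat) : 10000 <= center (S n).
Proof. rewrite center_S. generalize (pow_10000_ge_1 n). lra. Qed.

(** The tolerance has a factor 1 / [center (S n)] because [E] multiplies errors near b by about that
    center. The bound 1/500 leaves slack below the 1/50 of the trap for the errors of patching and
    of later corrections. *)
Lemma stage_target (n : nat) (phi : C -> C) :
  c1_entire phi -> stage n phi ->
  exists tau b, c1_entire tau /\ 100 * exp b = center (S n) /\
    (forall z, Cmod z <= rho (S n) ->
       Cmod (tau (giter phi n z) - (b + z / center (S n)))%C <= tol (S n) / (4 * center (S n))) /\
    (forall t, exists t', Rabs (t' - t) <= half_pow (S n) /\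
       Cmod (tau (giter phi n (sigma n * cis t')%C)) <= 1 / 500).
Proof.
  intros Ep Sn.
  assert (Ha := center_S_ge n). set (a := center (S n)) in *.
  assert (Hh := half_pow_pos n). assert (Hh1 := half_pow_le_1 n).
  assert (He : 0 < tol (S n)) by (unfold tol; generalize (half_pow_pos (S n)); lra).
  set (b := ln (a / 100)).
  assert (Hb : 100 * exp b = a) by (unfold b; rewrite exp_ln by lra; field).
  assert (Hb0 : 0 < b) by (unfold b; rewrite <- ln_1; apply ln_increasing; lra).
  set (kap := tol (S n) / (8 * a)).
  assert (Hkap : 0 < kap) by (apply Rdiv_lt_0_compat; lra).
  (* The midpoint lies [half_pow n / 8] above [rho (S n)], so an inverse with error at most that
     sends the smaller disc into |t| <= x, where (t / sigma)^N is small. *)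
  set (x := (rho (S n) + sigma n) / 2).
  assert (Hx : 0 <= x < sigma n) by (unfold x, rho, sigma; rewrite half_pow_S; lra).
  assert (Hsig : 1 < sigma n <= 7 / 4) by (unfold sigma; lra).
  assert (Hq : 0 <= x / sigma n < 1).
  { split; [apply Rdiv_le_0_compat; lra|]. apply Rlt_div_l; lra. }
  destruct (pow_lt_eps (x / sigma n) b kap Hq Hkap) as [N1 HN1].
  destruct (INR_unbounded (4 / half_pow (S n))) as [N2 HN2].
  (* [N1] makes the power term negligible on the smaller disc, and [N2] makes the N-th roots of -1
     dense enough on the circle. *)
  set (N := S (N1 + N2)).
  set (pw := fun t : C => (b * (t / sigma n) ^ N)%C).
  assert (Hs0 : RtoC (sigma n) <> 0) by (intros Q; apply RtoC_inj in Q; lra).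
  assert (Ha0 : RtoC a <> 0) by (intros Q; apply RtoC_inj in Q; lra).
  assert (Epw : c1_entire pw).
  { apply (c1_entire_mult (fun _ => RtoC b)); [apply c1_entire_const|].
    apply c1_entire_pow. apply (c1_entire_mult (fun t => t)); [exact c1_entire_id|].
    apply c1_entire_const. }
  destruct (c1_entire_lipschitz pw 3 Epw) as [K [HK HLip]].
  (* The inverse is chosen after N: a large N makes [pw] steep, and the cancellation of b must
     survive an error eta amplified by [K]. *)
  set (eta := Rmin (Rmin (half_pow n / 8) (tol (S n) / 8)) (Rmin (1 / 10) (1 / 1000 / K))).
  assert (Heta : 0 < eta).
  { repeat apply Rmin_pos; try lra. apply Rdiv_lt_0_compat; lra. }
  assert (He1 : eta <= half_pow n / 8) by (eapply Rle_trans; [apply Rmin_l | apply Rmin_l]).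
  assert (He2 : eta <= tol (S n) / 8) by (eapply Rle_trans; [apply Rmin_l | apply Rmin_r]).
  assert (He3 : eta <= 1 / 10) by (eapply Rle_trans; [apply Rmin_r | apply Rmin_l]).
  assert (He4 : eta * K <= 1 / 1000).
  { apply Rle_div_r; [exact HK|]. eapply Rle_trans; [apply Rmin_r | apply Rmin_r]. }
  destruct (stage_inverse n phi eta Ep Sn Heta) as [T [ET HT]].
  exists (fun u => b + T u / a + pw (T u))%C, b. split; [|split; [exact Hb|split]].
  - apply (c1_entire_plus (fun u => b + T u / a)%C).
    + apply (c1_entire_plus (fun _ => RtoC b)); [apply c1_entire_const|].
      apply (c1_entire_mult T); [exact ET | apply c1_entire_const].
    + now apply (c1_entire_comp pw).
  - intros z Hz.
    assert (Hz' : Cmod z <= sigma n) by (unfold rho, sigma in *; rewrite half_pow_S in Hz; lra).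
    specialize (HT z Hz'). set (t := T (giter phi n z)) in *.
    assert (Ht : Cmod t <= x).
    { eapply Rle_trans; [apply (Cmod_le_minus _ z)|].
      unfold x, rho, sigma in *; rewrite half_pow_S in *. lra. }
    assert (Hpw : Cmod (pw t) <= kap).
    { unfold pw. rewrite Cmod_mult, Cmod_pow, Cmod_div, !Cmod_R, !Rabs_pos_eq by (assumption || lra).
      eapply Rle_trans; [|exact HN1]. apply Rmult_le_compat_l; [lra|].
      apply Rle_trans with ((x / sigma n) ^ N).
      - apply pow_incr. split; [apply Rdiv_le_0_compat; [apply Cmod_ge_0 | lra]|].
        apply Rmult_le_compat_r; [apply Rlt_le, Rinv_0_lt_compat|]; lra.
      - replace N with (N1 + S N2)%nat by (unfold N; lia). rewrite pow_add.
        assert ((x / sigma n) ^ S N2 <= 1) by (apply pow_le_1; lra).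
        assert (0 <= (x / sigma n) ^ N1) by (apply pow_le; lra). nra. }
    replace (b + t / a + pw t - (b + z / a))%C with ((t - z) / a + pw t)%C by (field; exact Ha0).
    eapply Rle_trans; [apply Cmod_triangle|].
    replace (tol (S n) / (4 * a)) with (tol (S n) / 8 / a + kap) by (unfold kap; field; lra).
    apply Rplus_le_compat; [|exact Hpw].
    rewrite Cmod_div, Cmod_R, Rabs_pos_eq by (assumption || lra).
    apply Rmult_le_compat_r; [apply Rlt_le, Rinv_0_lt_compat|]; lra.
  - intros s. destruct (roots_of_minus_one_dense N s) as [s' [Hs' Hroot]]; [unfold N; lia|].
    exists s'. split.
    + eapply Rle_trans; [exact Hs'|].
      assert (INR N2 <= INR N) by (apply le_INR; unfold N; lia).
      assert (Hh2 := half_pow_pos (S n)).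
      assert (0 < INR N2) by (eapply Rlt_trans; [|exact HN2]; apply Rdiv_lt_0_compat; lra).
      apply Rle_div_l; [lra|]. apply Rlt_div_l in HN2; [|exact Hh2]. nra.
    + set (z := (sigma n * cis s')%C).
      assert (Hz : Cmod z = sigma n).
      { unfold z. rewrite Cmod_mult, Cmod_cis, Cmod_R, Rabs_pos_eq; lra. }
      specialize (HT z ltac:(lra)). set (t := T (giter phi n z)) in *.
      assert (Ht : Cmod t <= 3).
      { eapply Rle_trans; [apply (Cmod_le_minus _ z)|]. lra. }
      assert (Hpz : pw z = (- b)%C).
      { unfold pw, z. replace (sigma n * cis s' / sigma n)%C with (cis s') by (field; exact Hs0).
        rewrite Hroot. ring. }
      replace (b + t / a + pw t)%C with (t / a + (pw t - pw z))%C by (rewrite Hpz; ring).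
      eapply Rle_trans; [apply Cmod_triangle|].
      rewrite Cmod_div, Cmod_R, Rabs_pos_eq by (assumption || lra).
      assert (Cmod t / a <= 3 / 10000).
      { apply Rle_div_l; [lra|]. nra. }
      assert (Cmod (pw t - pw z)%C <= K * Cmod (t - z)%C) by (apply HLip; lra).
      assert (K * Cmod (t - z)%C <= K * eta) by (apply Rmult_le_compat_l; lra).
      lra.
Qed.

Lemma stage_step (n : nat) (phi : C -> C) (delta : R) :
  stable_stage n phi delta ->
  exists phi' delta', stable_stage (S n) phi' delta' /\ delta' <= delta / 2 /\
    forall u, dom n u -> Cmod (phi' u - phi u)%C <= delta / 2.
Proof.
  intros [Ep [Hd Hst]].
  assert (Hzero : forall w : C, Cmod (w - w)%C = 0).
  { intros w. replace (w - w)%C with (RtoC 0) by ring. apply Cmod_0. }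
  assert (Sn : stage n phi).
  { apply Hst. intros u _. rewrite Hzero. lra. }
  destruct (stage_target n phi Ep Sn) as [tau [b [Et [Hb [Htau Hpts]]]]].
  assert (Ha := center_S_ge n). assert (Hha := half_pow_center n). set (a := center (S n)) in *.
  assert (Hh := half_pow_pos n). assert (Hh1 := half_pow_le_1 n).
  assert (He : 0 < tol (S n)) by (unfold tol; generalize (half_pow_pos (S n)); lra).
  assert (Hea : 300 <= tol (S n) * a) by (unfold tol; lra).
  assert (He1 : tol (S n) <= 1 / 16) by (unfold tol; generalize (half_pow_le_1 (S n)); lra).
  (* The unit of error for values of phi. The target and the patch cost 2 [kap] each, hence
     [tol (S n) / 2] after [E]; the quadratic error of [E] and the later perturbation to psi take a
     quarter of [tol (S n)] each. *)
  set (kap := tol (S n) / (8 * a)).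
  assert (Hkap : 0 < kap) by (apply Rdiv_lt_0_compat; lra).
  assert (Hkap1 : kap <= 1 / 10000).
  { apply Rle_div_l; nra. }
  destruct (c1_entire_lipschitz tau (dom_radius (S n)) Et) as [L [HL HLip]].
  set (e1 := Rmin (1 / 2) (kap / L)).
  assert (He10 : 0 < e1) by (apply Rmin_pos; [lra | now apply Rdiv_lt_0_compat]).
  assert (He11 : e1 <= 1 / 2) by apply Rmin_l.
  assert (He12 : e1 * L <= kap) by (apply Rle_div_r; [exact HL | apply Rmin_r]).
  destruct (giter_perturb phi (dom n) (fun z => Cmod z <= rho n) (dom_radius (S n)) n Ep (dom_bound n))
    with (eps := e1) as [d1 [Hd1 Hpert]].
  { intros z j Hz Hj u Hu.
    assert (Hb1 := proj1 (proj2 Sn) j z Hj Hz).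
    destruct n as [|n]; [lia|]. apply dom_S_iff.
    eapply Rle_trans; [apply (Cmod_le_minus _ (giter phi j z))|]. lra. }
  { exact He10. }
  set (alpha := Rmin (delta / 2) (Rmin d1 kap)).
  assert (Hal : 0 < alpha) by (repeat apply Rmin_pos; lra).
  assert (Hal1 : alpha <= delta / 2) by apply Rmin_l.
  assert (Hal2 : alpha <= d1) by (eapply Rle_trans; [apply Rmin_r | apply Rmin_l]).
  assert (Hal3 : alpha <= kap) by (eapply Rle_trans; [apply Rmin_r | apply Rmin_r]).
  destruct (stage_patch n phi tau alpha Ep Et Hal) as [phi' [Ep' [Hold Hnew]]].
  (* One [kap] pays for replacing phi' by tau near [center n], the other for the change of the first
     n iterates, amplified by the Lipschitz constant of tau. *)
  assert (Hval : forall z, Cmod z <= rho n ->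
    Cmod (phi' (giter phi' n z) - tau (giter phi n z))%C <= 2 * kap).
  { intros z Hz.
    assert (Hw : Cmod (giter phi' n z - giter phi n z)%C <= e1).
    { apply Hpert; [|exact Hz|lia]. intros u Hu. generalize (Hold u Hu). lra. }
    assert (Hc := stage_near_center n phi z Sn Hz).
    set (w := giter phi n z) in *. set (w' := giter phi' n z) in *.
    assert (Hc' : Cmod (w' - center n)%C <= 3).
    { eapply Rle_trans; [apply (Cmod_tri _ _ w)|]. lra. }
    assert (Hbig : forall v, Cmod (v - center n)%C <= 3 -> Cmod v <= dom_radius (S n)).
    { intros v Hv. eapply Rle_trans; [apply (Cmod_le_minus _ (center n))|].
      rewrite Cmod_R, Rabs_pos_eq by apply center_nonneg. generalize (center_dom_radius n); lra. }
    assert (A1 := Hnew w' Hc').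
    assert (A2 := HLip w w' (Hbig w ltac:(lra)) (Hbig w' Hc')).
    eapply Rle_trans; [apply (Cmod_tri _ _ (tau w'))|].
    assert (L * Cmod (w' - w)%C <= L * e1) by (apply Rmult_le_compat_l; lra). lra. }
  assert (Sn' : stage n phi') by (apply Hst; intros u Hu; generalize (Hold u Hu); lra).
  (* Stability is needed up to [rho n], not just [rho (S n)], because the trapped points lie on the
     circle of radius [sigma n]. *)
  destruct (giter_perturb phi' (dom (S n)) (fun z => Cmod z <= rho n) (dom_radius (S n)) (S n) Ep'
     (fun u Hu => proj1 (dom_S_iff n u) Hu)) with (eps := tol (S n) / 4) as [d2 [Hd2 Hpert']].
  { intros z j Hz Hj u Hu. apply dom_S_iff.
    assert (A := stage_orbit_bound n phi' j z Sn' Hj Hz).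
    eapply Rle_trans; [apply (Cmod_le_minus _ (giter phi' j z))|]. lra. }
  { lra. }
  set (delta' := Rmin d2 (delta / 2)).
  exists phi', delta'. split; [|split; [apply Rmin_r|]].
  2:{ intros u Hu. generalize (Hold u Hu). lra. }
  split; [exact Ep'|]. split; [apply Rmin_pos; lra|].
  intros psi Hpsi.
  assert (Hpsi2 : forall u, dom (S n) u -> Cmod (psi u - phi' u)%C <= d2).
  { intros u Hu. eapply Rle_trans; [now apply Hpsi | apply Rmin_l]. }
  assert (Spsi : stage n psi).
  { apply Hst. intros u Hu.
    eapply Rle_trans; [apply (Cmod_tri _ _ (phi' u))|].
    assert (dom (S n) u) by (apply dom_S_iff; now apply dom_bound).
    generalize (Hold u Hu) (Rle_trans _ _ _ (Hpsi u H) (Rmin_r _ _)). lra. }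
  assert (Hrho : rho (S n) <= rho n) by (unfold rho; rewrite half_pow_S; lra).
  split; [|split].
  - intros z Hz.
    assert (Hz2 : Cmod z <= rho n) by lra.
    assert (HE : Cmod (giter phi' (S n) z - a - z)%C <= tol (S n) / 2 + 27 / a).
    { rewrite giter_S. apply (E_near_affine a b); auto; try lra.
      - unfold rho in Hz2. lra.
      - eapply Rle_trans; [apply (Cmod_tri _ _ (tau (giter phi n z)))|].
        generalize (Hval z Hz2) (Htau z Hz).
        replace (tol (S n) / (4 * a)) with (2 * kap) by (unfold kap; field; lra).
        replace (tol (S n) / 2 / a) with (4 * kap) by (unfold kap; field; lra). lra. }
    assert (27 / a <= tol (S n) / 4) by (apply Rle_div_l; lra).
    generalize (Hpert' psi Hpsi2 z (S n) Hz2 (Nat.le_refl _)). intros HP.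
    change (center (S n)) with a. replace (giter psi (S n) z - a - z)%C
      with ((giter psi (S n) z - giter phi' (S n) z) + (giter phi' (S n) z - a - z))%C by ring.
    eapply Rle_trans; [apply Cmod_triangle|]. lra.
  - intros j z Hj Hz. apply (stage_orbit_bound n); auto; lra.
  - intros t. destruct (Hpts t) as [t' [Ht' Hv]]. exists t'. split; [exact Ht'|].
    set (z := (sigma n * cis t')%C) in *.
    assert (Hz : Cmod z <= rho n).
    { unfold z. rewrite Cmod_mult, Cmod_cis, Cmod_R, Rabs_pos_eq; unfold sigma, rho; lra. }
    generalize (Hpert' psi Hpsi2 z (S n) Hz (Nat.le_refl _)). intros HP.
    eapply Rle_trans; [apply (Cmod_tri _ _ (giter phi' (S n) z))|].
    assert (Hv' : Cmod (phi' (giter phi' n z)) <= 1 / 100).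
    { eapply Rle_trans; [apply (Cmod_le_minus _ (tau (giter phi n z)))|].
      generalize (Hval z Hz). lra. }
    generalize (E_near_100 (phi' (giter phi' n z)) ltac:(lra)). rewrite <- giter_S. lra.
Qed.

(** The zero function sends every point to the center of the trap under [E], and closeness 1/50 to
    it is the trap condition itself. *)
Lemma stage_zero : stable_stage 0 (fun _ => RtoC 0) (1 / 50).
Proof.
  split; [apply c1_entire_const|]. split; [lra|].
  intros psi Hpsi. split; [|split].
  - intros z _. change (Cmod (z - 0 - z)%C <= tol 0).
    replace (z - 0 - z)%C with (RtoC 0) by ring. rewrite Cmod_0.
    unfold tol. generalize (half_pow_pos 0). lra.
  - intros j z Hj. lia.
  - intros u Hu. specialize (Hpsi u Hu). now replace (psi u - 0)%C with (psi u) in Hpsi by ring.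
Qed.

Lemma staged_function : exists phi, (forall z, exists l, cderiv phi z l) /\ forall n, stage n phi.
Proof.
  (* Carrying the stage index as data keeps the recursion non-dependent; [Hidx] recovers it
     afterwards. *)
  set (X := { s : nat * ((C -> C) * R) | stable_stage (fst s) (fst (snd s)) (snd (snd s)) }).
  assert (step : forall s : X, { s' : X |
      fst (proj1_sig s') = S (fst (proj1_sig s)) /\
      snd (snd (proj1_sig s')) <= snd (snd (proj1_sig s)) / 2 /\
      forall u, dom (fst (proj1_sig s)) u ->
        Cmod (fst (snd (proj1_sig s')) u - fst (snd (proj1_sig s)) u)%C
          <= snd (snd (proj1_sig s)) / 2 }).
  { intros [[n [phi delta]] Hs]. apply constructive_indefinite_description.
    destruct (stage_step n phi delta Hs) as [phi' [delta' [H1 H2]]].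
    exists (exist _ (S n, (phi', delta')) H1). simpl. tauto. }
  set (seq := fix seq n : X := match n with
     | O => exist _ (O, (fun _ => RtoC 0, 1 / 50)) stage_zero
     | S k => proj1_sig (step (seq k)) end).
  set (ph := fun n => fst (snd (proj1_sig (seq n)))).
  set (de := fun n => snd (snd (proj1_sig (seq n)))).
  assert (Hidx : forall n, fst (proj1_sig (seq n)) = n).
  { induction n as [|n IH]; [reflexivity|].
    simpl. rewrite (proj1 (proj2_sig (step (seq n)))). now rewrite IH. }
  assert (Hst : forall n, stable_stage n (ph n) (de n)).
  { intros n. rewrite <- (Hidx n) at 1. exact (proj2_sig (seq n)). }
  assert (Hde : forall n, de (S n) <= de n / 2).
  { intros n. exact (proj1 (proj2 (proj2_sig (step (seq n))))). }
  assert (Hph : forall n u, dom n u -> Cmod (ph (S n) u - ph n u)%C <= de n / 2).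
  { intros n u Hu. apply (proj2 (proj2 (proj2_sig (step (seq n))))). now rewrite Hidx. }
  assert (Hpos : forall n, 0 < de n) by (intros n; apply (Hst n)).
  assert (Hmono : forall n u, dom n u -> dom (S n) u).
  { intros n u Hu. apply dom_S_iff. now apply dom_bound. }
  (* Since [de] at least halves, each correction of size [de n / 2] is at most [de n - de (S n)],
     and the sum telescopes. *)
  assert (Hfar : forall k n u, dom n u -> Cmod (ph (n + k)%nat u - ph n u)%C <= de n - de (n + k)%nat).
  { induction k as [|k IH]; intros n u Hu.
    - rewrite Nat.add_0_r. replace (ph n u - ph n u)%C with (RtoC 0) by ring. rewrite Cmod_0. lra.
    - rewrite <- Nat.add_succ_comm.
      eapply Rle_trans; [apply (Cmod_tri _ _ (ph (S n) u))|].
      generalize (IH (S n) u (Hmono n u Hu)) (Hph n u Hu) (Hde n). lra. }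
  assert (Hcl : forall n m u, (n <= m)%nat -> dom n u -> Cmod (ph m u - ph n u)%C <= de n).
  { intros n m u Hnm Hu. replace m with (n + (m - n))%nat by lia.
    generalize (Hfar (m - n)%nat n u Hu) (Hpos (n + (m - n))%nat). lra. }
  assert (Hde0 : forall n, de n <= (1 / 2) ^ n).
  { induction n as [|n IH]; [unfold de; simpl; lra|].
    generalize (Hde n). simpl. lra. }
  assert (Hdom : forall r, exists n, forall m u, (n <= m)%nat -> Cmod u <= r -> dom m u).
  { intros r. destruct (INR_unbounded r) as [n Hn]. exists (S n). intros m u Hm Hu.
    destruct m as [|m]; [lia|]. apply dom_S_iff.
    assert (INR n <= INR m) by (apply le_INR; lia).
    assert (INR m <= 10000 ^ m).
    { clear. induction m as [|m IH]; [simpl; lra|]. rewrite S_INR. simpl.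
      generalize (pow_10000_ge_1 m). lra. }
    unfold dom_radius. simpl. generalize (pow_10000_ge_1 m). lra. }
  assert (Hsmall : forall eps, 0 < eps -> exists N, forall n, (N <= n)%nat -> de n <= eps).
  { intros eps Heps. destruct (pow_lt_eps (1 / 2) 1 eps) as [N HN]; [lra | exact Heps |].
    exists N. intros n Hn. eapply Rle_trans; [apply Hde0|].
    replace n with (N + (n - N))%nat by lia. rewrite pow_add.
    assert ((1 / 2) ^ (n - N) <= 1) by (apply pow_le_1; lra).
    assert (0 < (1 / 2) ^ N) by (apply pow_lt; lra). nra. }
  assert (Hlim : forall u, exists l, forall eps, 0 < eps -> exists N, forall n, (N <= n)%nat ->
     Cmod (ph n u - l)%C <= eps).
  { intros u. apply C_complete. intros eps Heps.
    destruct (Hdom (Cmod u)) as [N1 HN1]. destruct (Hsmall (eps / 2)) as [N2 HN2]; [lra|].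
    exists (max N1 N2). intros n m Hn Hm.
    assert (Hu : dom (max N1 N2) u) by (apply HN1; [lia | lra]).
    eapply Rle_trans; [apply (Cmod_tri _ _ (ph (max N1 N2) u))|].
    rewrite (Cmod_minus_sym (ph (max N1 N2) u)).
    generalize (Hcl _ n u Hn Hu) (Hcl _ m u Hm Hu) (HN2 (max N1 N2) ltac:(lia)). lra. }
  set (phi := fun u => proj1_sig (constructive_indefinite_description _ (Hlim u))).
  assert (Hphi : forall u eps, 0 < eps -> exists N, forall n, (N <= n)%nat ->
     Cmod (ph n u - phi u)%C <= eps)
    by (intros u; exact (proj2_sig (constructive_indefinite_description _ (Hlim u)))).
  assert (Hclose : forall n u, dom n u -> Cmod (phi u - ph n u)%C <= de n).
  { intros n u Hu. apply le_epsilon. intros eps Heps.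
    destruct (Hphi u eps Heps) as [N HN].
    eapply Rle_trans; [apply (Cmod_tri _ _ (ph (max n N) u))|].
    rewrite (Cmod_minus_sym (phi u)).
    generalize (HN (max n N) ltac:(lia)) (Hcl n (max n N) u ltac:(lia) Hu). lra. }
  exists phi. split.
  - intros z. apply (Weierstrass_limit ph).
    + intros n. apply (Hst n).
    + intros r eps Heps. destruct (Hdom r) as [N1 HN1]. destruct (Hsmall eps Heps) as [N2 HN2].
      exists (max N1 N2). intros n Hn w Hw. rewrite Cmod_minus_sym.
      generalize (Hclose n w (HN1 n w ltac:(lia) Hw)) (HN2 n ltac:(lia)). lra.
  - intros n. apply (Hst n). apply Hclose.
Qed.

(** * Dynamics of the limit function *)

Lemma open_Cmod (A : C -> Prop) (z : C) :
  open A -> A z -> exists d, 0 < d /\ forall w, Cmod (w - z)%C < d -> A w.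
Proof. intros HA Hz. apply locally_Cmod. now apply HA. Qed.

Lemma open_of_Cmod (A : C -> Prop) :
  (forall z, A z -> exists d, 0 < d /\ forall w, Cmod (w - z)%C < d -> A w) -> open A.
Proof. intros H z Hz. apply locally_Cmod. now apply H. Qed.

(** On a segment from A to B, m is the supremum of the times up to which the path stays in A. If g m
    lies in A, then m can be increased unless it is 1; if g m lies in B, times just below m lie in
    both. *)
Lemma convex_connected (S : C -> Prop) :
  (forall x y t, S x -> S y -> 0 <= t <= 1 -> S (x + t * (y - x))%C) -> connected S.
Proof.
  intros Hconv A B OA OB Hcov [p [Sp Ap]] [q [Sq Bq]].
  set (g := fun t : R => (p + t * (q - p))%C).
  assert (Sg : forall t, 0 <= t <= 1 -> S (g t)) by (intros; now apply Hconv).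
  assert (g0 : g 0 = p) by (unfold g; ring).
  assert (g1 : g 1 = q) by (unfold g; ring).
  assert (Hopen : forall D, open D -> forall m, D (g m) ->
    exists d, 0 < d /\ forall s, Rabs (s - m) < d -> D (g s)).
  { intros D OD m Hm. destruct (open_Cmod D _ OD Hm) as [d [Hd H]].
    assert (HK : 0 < 1 + Cmod (q - p)%C) by (generalize (Cmod_ge_0 (q - p)%C); lra).
    exists (d / (1 + Cmod (q - p)%C)). split; [now apply Rdiv_lt_0_compat|].
    intros s Hs. apply H. apply Rlt_div_r in Hs; [|exact HK].
    replace (g s - g m)%C with (RtoC (s - m) * (q - p))%C by (unfold g; rewrite RtoC_minus; ring).
    rewrite Cmod_mult, Cmod_R. generalize (Rabs_pos (s - m)). nra. }
  set (X := fun t => 0 <= t <= 1 /\ forall s, 0 <= s <= t -> A (g s)).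
  destruct (completeness X) as [m [Hub Hlub]].
  { exists 1. intros t [Ht _]. lra. }
  { exists 0. split; [lra|]. intros s Hs. replace s with 0 by lra. now rewrite g0. }
  assert (Hm : 0 <= m <= 1).
  { split; [|apply Hlub; intros t [Ht _]; lra]. apply Hub. split; [lra|].
    intros s Hs. replace s with 0 by lra. now rewrite g0. }
  assert (Happ : forall d, 0 < d -> exists t, X t /\ m - d < t <= m).
  { intros d Hd. apply NNPP. intros Hn.
    assert (m <= m - d); [|lra]. apply Hlub. intros t Xt.
    destruct (Rle_lt_dec t (m - d)) as [h|h]; [exact h|].
    exfalso. apply Hn. exists t. split; [exact Xt|]. split; [exact h | now apply Hub]. }
  destruct (Hcov (g m) (Sg m Hm)) as [HA | HB].
  - destruct (Hopen A OA m HA) as [d [Hd H]].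
    destruct (Happ d Hd) as [t [[Ht Xt] Htm]].
    destruct (Rle_lt_dec 1 m) as [h|h].
    + exists q. replace m with 1 in HA by lra. rewrite g1 in HA. tauto.
    + assert (X (Rmin 1 (m + d / 2))).
      { split; [split; [apply Rmin_glb; lra | apply Rmin_l]|]. intros s Hs.
        assert (s <= m + d / 2) by (eapply Rle_trans; [apply Hs | apply Rmin_r]).
        destruct (Rle_lt_dec s t) as [h'|h']; [apply Xt; lra|].
        apply H. apply Rabs_lt_between. lra. }
      apply Hub in H0. unfold Rmin in H0. destruct (Rle_dec 1 (m + d / 2)); lra.
  - destruct (Hopen B OB m HB) as [d [Hd H]].
    destruct (Happ d Hd) as [t [[Ht Xt] Htm]].
    exists (g t). repeat split; [now apply Sg | apply Xt; lra |].
    apply H. apply Rabs_lt_between. lra.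
Qed.

(** A finite value within 1/4 of y has modulus at most 5/3, too small to be near x; infinity is far
    from every y with |y| <= 1. *)
Lemma chordal_separation (x y : C) (h : sphere) :
  10 <= Cmod x -> Cmod y <= 1 -> chordal (Some x) h < 1 / 4 -> 1 / 4 <= chordal (Some y) h.
Proof.
  intros Hx Hy H.
  assert (Hsq : forall a, 0 <= a -> 0 < sqrt (1 + a ^ 2) <= 1 + a).
  { intros a Ha. split; [apply sqrt_lt_R0; nra|].
    rewrite <- (sqrt_square (1 + a)) by lra. apply sqrt_le_1_alt. nra. }
  destruct (Hsq _ (Cmod_ge_0 x)) as [X1 X2]. destruct (Hsq _ (Cmod_ge_0 y)) as [Y1 Y2].
  unfold chordal in *. destruct h as [c|].
  - apply Rnot_lt_le. intros H'.
    destruct (Hsq _ (Cmod_ge_0 c)) as [C1 C2].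
    set (sx := sqrt (1 + Cmod x ^ 2)) in *. set (sy := sqrt (1 + Cmod y ^ 2)) in *.
    set (sc := sqrt (1 + Cmod c ^ 2)) in *.
    assert (Px : 0 < sx * sc) by now apply Rmult_lt_0_compat.
    assert (Py : 0 < sy * sc) by now apply Rmult_lt_0_compat.
    apply (proj1 (Rlt_div_l _ _ _ Px)) in H. apply (proj1 (Rlt_div_l _ _ _ Py)) in H'.
    generalize (Cmod_le_minus x c) (Cmod_le_minus c y) (Cmod_ge_0 c) (Cmod_ge_0 y).
    rewrite (Cmod_minus_sym c y). intros.
    assert (sx * sc <= (1 + Cmod x) * (1 + Cmod c)) by (apply Rmult_le_compat; lra).
    assert (sy * sc <= 2 * (1 + Cmod c)) by (apply Rmult_le_compat; lra).
    assert (Cmod c <= 5 / 3) by lra.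
    nra.
  - apply (proj1 (Rle_div_r _ _ _ Y1)). lra.
Qed.

(** The gap exceeds twice 2 + 1/16, so the discs containing images under different iterates are
    disjoint. *)
Lemma center_gap (n m : nat) : (n < m)%nat -> center n + 100 <= center m.
Proof.
  intros Hnm. replace m with (S (n + (m - n - 1)))%nat by lia.
  rewrite center_S, pow_add.
  assert (Hn : center n <= 10000 ^ n) by (destruct n; simpl; lra).
  generalize (pow_10000_ge_1 n) (pow_10000_ge_1 (m - n - 1)). nra.
Qed.

Lemma increasing_ge_id (p : nat -> nat) :
  (forall k, (p k < p (S k))%nat) -> forall k, (k <= p k)%nat.
Proof. intros H k. induction k as [|k IH]; [lia|]. specialize (H k). lia. Qed.

Lemma constant_subsequence (s : nat -> nat) (v : nat) :
  (forall N, exists k, (N <= k)%nat /\ s k = v) ->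
  exists p, (forall k, (p k < p (S k))%nat) /\ forall k, s (p k) = v.
Proof.
  intros H.
  set (next := fun N => proj1_sig (constructive_indefinite_description _ (H N))).
  assert (Hn : forall N, (N <= next N)%nat /\ s (next N) = v)
    by (intros N; exact (proj2_sig (constructive_indefinite_description _ (H N)))).
  exists (fix p k := match k with O => next O | S k => next (S (p k)) end). split.
  - intros k. apply Hn.
  - intros [|k]; apply Hn.
Qed.

Lemma tends_to_infinity_of_finite_fibers (s : nat -> nat) :
  (forall v, exists N, forall k, (N <= k)%nat -> s k <> v) ->
  forall M, exists N, forall k, (N <= k)%nat -> (M <= s k)%nat.
Proof.
  intros H M. induction M as [|M [N1 IH]]; [exists O; lia|].
  destruct (H M) as [N2 H2]. exists (max N1 N2). intros k Hk.
  specialize (IH k ltac:(lia)). specialize (H2 k ltac:(lia)). lia.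
Qed.

Section HalfPlane.

Variable phi : C -> C.
Hypotheses (Dphi : forall z, exists l, cderiv phi z l) (Sphi : forall n, stage n phi).

Let f (z : C) : C := phi (E z).
(** This is |E z| < 1, in the shape that [half_plane] asks for. *)
Let H (z : C) : Prop := ln 100 < Re (RtoC (-1) * z)%C.

Lemma semiconjugacy (n : nat) (z : C) : E (iterate f n z) = giter phi n (E z).
Proof.
  induction n as [|n IH]; [reflexivity|]. rewrite giter_S, <- IH. reflexivity.
Qed.

Lemma iterate_S_eq (n : nat) (z : C) : iterate f (S n) z = phi (giter phi n (E z)).
Proof. rewrite <- semiconjugacy. reflexivity. Qed.

Lemma cderiv_lift (z : C) : exists l, cderiv f z l.
Proof.
  destruct (Dphi (E z)) as [l Hl].
  destruct c1_entire_E as [[E' [HE _]] _].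
  exists (l * E' z)%C. now apply (cderiv_comp phi E).
Qed.

Lemma entire_lift : entire f.
Proof. intros z. destruct (cderiv_lift z) as [l Hl]. exact (cderiv_ex_derive f z l Hl). Qed.

Lemma ccont_iterate (n : nat) : ccont (iterate f n).
Proof.
  assert (Cf : ccont f).
  { apply (cderiv_cont f (fun z => proj1_sig (constructive_indefinite_description _ (cderiv_lift z)))).
    intros z. exact (proj2_sig (constructive_indefinite_description _ (cderiv_lift z))). }
  induction n as [|n IH].
  - exact (c1_entire_cont _ c1_entire_id).
  - now apply (ccont_comp f (iterate f n)).
Qed.

Lemma Cmod_E (z : C) : Cmod (E z) = 100 * exp (Re z).
Proof. unfold E. rewrite Cmod_mult, Cmod_Cexp, Cmod_R, Rabs_pos_eq; lra. Qed.

Lemma re_opp1 (z : C) : Re (RtoC (-1) * z)%C = - Re z.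
Proof. rewrite re_scal_l. ring. Qed.

Lemma exp_ln100 : exp (ln 100) = 100.
Proof. apply exp_ln. lra. Qed.

Lemma half_plane_disc (z : C) : H z -> Cmod (E z) < 1.
Proof.
  unfold H. rewrite re_opp1, Cmod_E. intros Hz.
  assert (A : exp (Re z) < exp (- ln 100)) by (apply exp_increasing; lra).
  rewrite exp_Ropp, exp_ln100 in A. lra.
Qed.

Lemma orbit_near_center (n : nat) (z : C) :
  Cmod (E z) <= 1 -> Cmod (E (iterate f n z) - center n)%C <= 2 + 1 / 16.
Proof.
  intros Hz. rewrite semiconjugacy. apply stage_near_center; [apply Sphi|].
  unfold rho. generalize (half_pow_pos n). lra.
Qed.

(** [E] of the orbit follows the centers, and |E w| = 100 e^{Re w}, so the real parts of the orbit
    tend to infinity. The closed disc is covered, so the boundary line escapes as well. *)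
Lemma orbit_escapes (B : R) :
  exists N, forall n z, (N <= n)%nat -> Cmod (E z) <= 1 -> B <= Cmod (iterate f n z).
Proof.
  destruct (INR_unbounded (100 * exp B + 3)) as [N HN].
  exists (S N). intros n z Hn Hz.
  assert (A := orbit_near_center n z Hz).
  assert (Hc : INR N <= center n).
  { destruct n as [|n]; [lia|]. rewrite center_S.
    assert (INR N <= INR n) by (apply le_INR; lia).
    assert (INR n <= 10000 ^ n).
    { clear. induction n as [|n IH]; [simpl; lra|]. rewrite S_INR. simpl.
      generalize (pow_10000_ge_1 n). lra. }
    generalize (pow_10000_ge_1 n). lra. }
  assert (A2 := Cmod_le_minus (center n) (E (iterate f n z))).
  rewrite Cmod_minus_sym, Cmod_R, Rabs_pos_eq, Cmod_E in A2 by apply center_nonneg.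
  assert (A3 : exp B < exp (Re (iterate f n z))) by lra.
  apply exp_lt_inv in A3.
  generalize (re_le_Cmod (iterate f n z)) (Rle_abs (Re (iterate f n z))). lra.
Qed.

Lemma half_plane_open : open H.
Proof.
  apply open_of_Cmod. unfold H. intros z Hz. rewrite re_opp1 in Hz.
  exists (- Re z - ln 100). split; [lra|]. intros w Hw. rewrite re_opp1.
  generalize (re_le_Cmod (w - z)%C) (Rle_abs (Re (w - z)%C)). rewrite re_minus. lra.
Qed.

Lemma half_plane_fatou (z : C) : H z -> fatou_set f z.
Proof.
  intros Hz. exists H. split; [exact half_plane_open|]. split; [exact Hz|].
  intros s.
  (* An index sequence taking one value infinitely often has a constant subsequence; any other tends
     to infinity, and then the iterates converge to the point at infinity. *)
  destruct (classic (exists v, forall N, exists k, (N <= k)%nat /\ s k = v)) as [[v Hv]|Hn].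
  - destruct (constant_subsequence s v Hv) as [p [Hp Hc]].
    exists p. split; [exact Hp|]. exists (fun w => Some (iterate f (S v) w)).
    intros x _. exists (fun _ => True). split; [apply open_true|]. split; [exact I|].
    intros eps Heps. exists O. intros k _ w _ _. rewrite Hc. unfold chordal.
    match goal with |- 2 * Cmod ?x / _ < _ => replace x with (RtoC 0) by ring end.
    rewrite Cmod_0. unfold Rdiv. rewrite Rmult_0_r, Rmult_0_l. exact Heps.
  - assert (Hs : forall v, exists N, forall k, (N <= k)%nat -> s k <> v).
    { intros v. apply NNPP. intros Hv. apply Hn. exists v. intros N.
      apply NNPP. intros HN. apply Hv. exists N. intros k Hk E0. apply HN. now exists k. }
    assert (Hinf := tends_to_infinity_of_finite_fibers s Hs).
    exists (fun k => k). split; [intros; lia|]. exists (fun _ => None).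
    intros x _. exists (fun _ => True). split; [apply open_true|]. split; [exact I|].
    intros eps Heps.
    destruct (orbit_escapes (2 / eps)) as [M HM]. destruct (Hinf M) as [N HN].
    exists N. intros k Hk w _ Hw. unfold chordal.
    assert (A := HM (S (s k)) w ltac:(specialize (HN k Hk); lia)
       (Rlt_le _ _ (half_plane_disc w Hw))).
    set (v := Cmod (iterate f (S (s k)) w)) in *.
    assert (0 < 2 / eps) by (apply Rdiv_lt_0_compat; lra).
    assert (v < sqrt (1 + v ^ 2)).
    { rewrite <- (sqrt_pow2 v) at 1 by lra. apply sqrt_lt_1_alt. nra. }
    apply Rlt_div_l; [lra|]. apply Rle_div_l in A; [|exact Heps]. nra.
Qed.

Lemma trapped (n k : nat) (z : C) :
  Cmod (giter phi n (E z) - 100)%C <= 5 -> Cmod (giter phi (n + k) (E z) - 100)%C <= 5.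
Proof.
  intros H0. induction k as [|k IH]; [now rewrite Nat.add_0_r|].
  rewrite Nat.add_succ_r, giter_S.
  assert (A := proj2 (proj2 (Sphi 0)) _ IH).
  generalize (E_near_100 _ A). lra.
Qed.

Lemma trapped_points_near_boundary (z : C) (d : R) :
  ln 100 = - Re z -> 0 < d ->
  exists q, Cmod (q - z)%C < d /\ exists N, forall n, (N <= n)%nat -> Cmod (iterate f n q) <= 1.
Proof.
  intros Hz Hd.
  destruct (pow_lt_eps (1 / 2) 1 (d / 4)) as [k Hk]; [lra | lra |].
  fold (half_pow k) in Hk.
  destruct (proj2 (proj2 (Sphi (S k))) (Im z)) as [t [Ht HP]].
  assert (Hh := half_pow_pos k). rewrite half_pow_S in Ht.
  assert (Hs : 1 < sigma k) by (unfold sigma; lra).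
  (* This is the logarithmic preimage of the trapped point: [E] maps it to [sigma k * cis t]. Its
     real part is off by ln (sigma k) <= sigma k - 1. *)
  exists (ln (sigma k) - ln 100, t). split.
  - eapply Rle_lt_trans; [apply Cmod_re_im|]. rewrite re_minus.
    change (Im (((ln (sigma k) - ln 100)%R, t) - z)%C) with (t - Im z).
    change (Re ((ln (sigma k) - ln 100)%R, t)) with (ln (sigma k) - ln 100).
    assert (0 < ln (sigma k)) by (rewrite <- ln_1; apply ln_increasing; lra).
    assert (ln (sigma k) <= half_pow k).
    { generalize (exp_ineq1_le (ln (sigma k))). rewrite exp_ln by lra. unfold sigma. lra. }
    rewrite Rabs_pos_eq; lra.
  - assert (HE : E ((ln (sigma k) - ln 100)%R, t) = (sigma k * cis t)%C).
    { unfold E. replace ((ln (sigma k) - ln 100)%R, t) with (RtoC (ln (sigma k) - ln 100) + (0%R, t))%C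
        by (unfold Cplus, RtoC; simpl; f_equal; ring).
      rewrite Cexp_plus, Cexp_RtoC. unfold Rminus. rewrite exp_plus, exp_Ropp, exp_ln100, exp_ln by lra.
      rewrite RtoC_mult, RtoC_inv by lra. unfold cis. field. }
    rewrite <- HE in HP.
    (* The iterate g^(k+1) enters the trap, and f^(m+1) = phi o g^m o E, so one further step makes
       the iterate of f small. *)
    exists (S (S k)). intros n Hn.
    replace n with (S (S k + (n - S (S k))))%nat by lia.
    rewrite iterate_S_eq.
    assert (A := trapped (S k) (n - S (S k)) _ HP).
    generalize (proj2 (proj2 (Sphi 0)) _ A). lra.
Qed.

(** An index k with a large iterate at z is fixed first; a trapped q is then taken so close that
    this iterate is still large at q. A later index k', depending on q, has a small iterate there.
    Uniformity of the convergence near z puts both values within 1/4 of the same h q. *)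
Lemma boundary_not_fatou (z : C) : ln 100 = - Re z -> ~ fatou_set f z.
Proof.
  intros Hz [U [OU [Uz HN]]].
  destruct (HN (fun k => k)) as [p [Hp [h Hh]]].
  destruct (Hh z Uz) as [V [OV [Vz HV]]].
  destruct (HV (1 / 4)) as [N HVN]; [lra|].
  assert (Ez : Cmod (E z) <= 1).
  { rewrite Cmod_E. replace (Re z) with (- ln 100) by lra. rewrite exp_Ropp, exp_ln100. lra. }
  destruct (orbit_escapes 11) as [M HM].
  set (k := max N M).
  assert (A := HM (S (p k)) z ltac:(generalize (increasing_ge_id p Hp k); lia) Ez).
  destruct (ccont_iterate (S (p k)) z 1 Rlt_0_1) as [d1 [Hd1 H1]].
  destruct (open_Cmod U z OU Uz) as [d2 [Hd2 H2]].
  destruct (open_Cmod V z OV Vz) as [d3 [Hd3 H3]].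
  destruct (trapped_points_near_boundary z (Rmin d1 (Rmin d2 d3)) Hz) as [q [Hq [L HL]]].
  { repeat apply Rmin_pos; assumption. }
  assert (Hq1 := Rlt_le_trans _ _ _ Hq (Rmin_l _ _)).
  assert (Hq2 := Rlt_le_trans _ _ _ (Rlt_le_trans _ _ _ Hq (Rmin_r _ _)) (Rmin_l _ _)).
  assert (Hq3 := Rlt_le_trans _ _ _ (Rlt_le_trans _ _ _ Hq (Rmin_r _ _)) (Rmin_r _ _)).
  specialize (H1 _ Hq1). replace (z + (q - z))%C with q in H1 by ring.
  rewrite Cmod_minus_sym in H1.
  assert (B1 : 10 <= Cmod (iterate f (S (p k)) q)).
  { generalize (Cmod_le_minus (iterate f (S (p k)) z) (iterate f (S (p k)) q)). lra. }
  set (k' := max N L).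
  assert (B2 : Cmod (iterate f (S (p k')) q) <= 1).
  { apply HL. generalize (increasing_ge_id p Hp k'). lia. }
  assert (C1 := HVN k ltac:(lia) q (H3 q Hq3) (H2 q Hq2)).
  assert (C2 := HVN k' ltac:(lia) q (H3 q Hq3) (H2 q Hq2)).
  generalize (chordal_separation _ _ _ B1 B2 C1). lra.
Qed.

Lemma half_plane_connected : connected H.
Proof.
  apply convex_connected. unfold H. intros x y t Hx Hy Ht.
  rewrite re_opp1 in *. rewrite re_plus, re_scal_l, re_minus. destruct (Rle_dec (Re x) (Re y)); nra.
Qed.

Lemma half_plane_wandering : wandering_domain f H.
Proof.
  split.
  - split; [|split; [exact half_plane_fatou | split; [exact half_plane_connected|]]].
    + exists (RtoC (- ln 100 - 1)). unfold H. rewrite re_opp1, re_RtoC. lra.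
    + intros S CS HS SF z Sz. apply NNPP. intros Hz.
      (* The boundary line misses the Fatou set, so a connected set of Fatou points reaching beyond
         H would be split by the two open sides. *)
      assert (Hcov : forall w, S w -> H w \/ Re w > - ln 100).
      { intros w Sw. unfold H. rewrite re_opp1.
        destruct (Rtotal_order (ln 100) (- Re w)) as [h|[h|h]]; [now left | | right; lra].
        exfalso. exact (boundary_not_fatou w h (SF w Sw)). }
      destruct (CS H (fun w => Re w > - ln 100)) as [w [_ [H1 H2]]]; auto.
      * exact half_plane_open.
      * apply open_of_Cmod. intros w Hw. exists (Re w + ln 100). split; [lra|].
        intros v Hv. generalize (re_le_Cmod (w - v)%C) (Rle_abs (Re (w - v)%C)).
        rewrite re_minus, (Cmod_minus_sym w). lra.
      * exists (RtoC (- ln 100 - 1)). assert (H (RtoC (- ln 100 - 1))).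
        { unfold H. rewrite re_opp1, re_RtoC. lra. }
        auto.
      * exists z. split; [exact Sz|]. destruct (Hcov z Sz); [contradiction | assumption].
      * unfold H in H1. rewrite re_opp1 in H1. lra.
  - assert (Hlt : forall n m w, (n < m)%nat -> image (iterate f n) H w ->
      image (iterate f m) H w -> False).
    { intros n m w Hnm [x [Hx ->]] [y [Hy Hxy]].
      assert (A := orbit_near_center n x (Rlt_le _ _ (half_plane_disc x Hx))).
      assert (B := orbit_near_center m y (Rlt_le _ _ (half_plane_disc y Hy))).
      rewrite <- Hxy in B.
      assert (D := Cmod_tri (center m) (center n) (E (iterate f n x))).
      rewrite (Cmod_minus_sym (center m) (E _)), <- RtoC_minus, Cmod_R in D.
      generalize (center_gap n m Hnm) (Rle_abs (center m - center n)). lra. }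
    intros n m Hnm w [Hn Hm].
    destruct (Nat.lt_gt_cases n m) as [h _]. destruct (h Hnm); eauto.
Qed.

End HalfPlane.

Theorem mainTheorem4 :
  exists f : C -> C, entire f /\
  exists H : C -> Prop, half_plane H /\ wandering_domain f H.
Proof.
  destruct staged_function as [phi [Dphi Sphi]].
  exists (fun z => phi (E z)). split; [now apply entire_lift|].
  exists (fun z => ln 100 < Re (RtoC (-1) * z)%C). split.
  - exists (RtoC (-1)), (ln 100). split; [|tauto].
    intros Q. apply RtoC_inj in Q. lra.
  - now apply half_plane_wandering.
Qed.
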